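(* Let $M$ be a real manifold of class $C^2$, $N\subset M$ a submanifold of class $C^2$, and $K$ a $C^1$ subbundle of $TM$ such that $K|_N\subset TN$. Let $\nabla$ be the $K$-partial connection on $T_NM=TM|_N/TN$ given by $\nabla_X\eta=[\tilde X,\tilde Y](x)\bmod T_xN$. Let $\gamma$ be a curve in $N$ running from $x_1\in N$ to $x_2\in N$ which is a smooth integral curve $\gamma(t)=X_t(x_1)$ of a $C^1$ $K$-tangent vector field $X$ (respectively, a piecewise smooth curve formed of integral curves of a finite number of $C^1$ $K$-tangent vector fields). Then the parallel translation $T_NM[x_1]\to T_NM[x_2]$ along $\gamma$ associated with $\nabla$ is the map induced on the fibers of $T_NM$ by the differential of the flow of $X$ (respectively, of the composed flow).
   Context: $K[x]$ and $T_NM[x]$ denote fibers at $x$. The connection: for $x\in N$, $X\in K[x]$ and $\eta$ a local $C^1$ section of the normal bundle $T_NM$ near $x$, $\tilde X$ is any $C^1$ local section of $K$ near $x$ with $\tilde X(x)=X$, and $\tilde Y$ is any $C^1$ local vector field on $M$ near $x$ whose restriction to $N$ represents $\eta$ modulo $TN$; the class $[\tilde X,\tilde Y](x)\bmod T_xN$ does not depend on the choices and defines a $K$-partial connection, i.e. a connection in which covariant derivatives $\nabla_X\eta$ are defined only for $X$ in $K$ (so $\nabla_{\phi X}\eta=\phi\nabla_X\eta$ and $\nabla_X(\phi\eta)=\phi\nabla_X\eta+(X\phi)\eta$). A $K$-tangent vector field is a (local) section of $K$. $X_t$ denotes its local flow on $M$. Since $X$ is tangent to $N$ along $N$, the differential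 of $X_t$ maps $T N$ to $TN$ along integral curves in $N$ and hence induces linear isomorphisms between fibers of $T_NM$; similarly for compositions of such flows. Parallel translation: for a smooth curve $\gamma:I\to N$ with $\dot\gamma(t)\in K[\gamma(t)]$, a curve $\eta(t)\in T_NM[\gamma(t)]$ is a horizontal lift of $\gamma$ if $\nabla_{\dot\gamma}\eta=0$; existence and uniqueness of horizontal lifts with given initial value give linear isomorphisms $\Phi_{t_0,t}:T_NM[\gamma(t_0)]\to T_NM[\gamma(t)]$, called parallel translation along $\gamma$. For piecewise smooth curves one composes these isomorphisms. *)

(* Defs.v *)
From HB Require Import structures.
From mathcomp Require Import all_boot all_order all_algebra.
From mathcomp Require Import all_classical all_reals all_analysis.
Set Implicit Arguments.
Unset Strict Implicit.
Unset Printing Implicit Defensive.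
Import Order.TTheory GRing.Theory Num.Theory.
Import numFieldNormedType.Exports.
Local Open Scope classical_set_scope.
Local Open Scope ring_scope.

Section Calculus.
Variable R : realType.

(* Only used for open A and for maps between finite-dimensional spaces, where
   continuity of x |-> 'd f x v for every v is continuity of the differential. *)
Definition C1_on (V W : normedModType R) (A : set V) (f : V -> W) :=
  forall x, A x ->
    differentiable f x /\ forall v, {for x, continuous (fun y => 'd f y v)}.

Definition C2_on (V W : normedModType R) (A : set V) (f : V -> W) :=
  C1_on A f /\ forall v, C1_on A (fun y => 'd f y v).

Definition segment (a b : R) : set R :=
  [set s | Num.min a b <= s <= Num.max a b].

(* One-sided at the endpoints of an interval I. *)
Definition deriv_within (V : normedModType R) (I : set R) (f : R -> V)
    (t : R) (l : V) :=
  (fun s => (s - t)^-1 *: (f s - f t)) @ within I t^' --> l.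

End Calculus.

(* The values of ccoord outside cdom, and of cparam outside the image of cdom,
   are irrelevant. *)
Record chart (R : realType) (m : nat) (M : topologicalType) := Chart {
  cdom : set M;
  ccoord : M -> 'rV[R]_m;
  cparam : 'rV[R]_m -> M;
  cdom_open : open cdom;
  cimg_open : open (ccoord @` cdom);
  ccoordK : forall x, cdom x -> cparam (ccoord x) = x;
  ccoord_cont : forall x, cdom x -> {for x, continuous ccoord};
  cparam_cont : forall z, (ccoord @` cdom) z -> {for z, continuous cparam}
}.

Definition C2_transition (R : realType) (m : nat) (M : topologicalType)
    (c c' : chart R m M) :=
  C2_on (ccoord c @` (cdom c `&` cdom c')) (ccoord c' \o cparam c).

Record manifoldC2 (R : realType) (m : nat) := ManifoldC2 {
  mspace :> topologicalType;
  mspace_hausdorff : hausdorff_space mspace;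
  mspace_second_countable : @second_countable mspace;
  atlas : set (chart R m mspace);
  atlas_cover : forall x : mspace, exists c, atlas c /\ cdom c x;
  atlas_compat : forall c c', atlas c -> atlas c' -> C2_transition c c';
  atlas_maximal : forall c,
    (forall c', atlas c' -> C2_transition c c' /\ C2_transition c' c) ->
    atlas c
}.

(* A tangent vector is given by its components in all the charts, subject to
   the transformation rule in tspace; components in the charts which do not
   contain the base point are set to 0, so that a vector is determined by its
   components. *)
Definition tvec (R : realType) (m : nat) (M : manifoldC2 R m) :=
  chart R m M -> 'rV[R]_m.
HB.instance Definition _ R m (M : manifoldC2 R m) :=
  GRing.Lmodule.on (tvec M).

Section Geometry.
Variables (R : realType) (m : nat) (M : manifoldC2 R m).
Implicit Types (x y : M) (c : chart R m M) (W : set M).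
Local Notation tvec := (tvec M).

Definition chart_at x c := atlas c /\ cdom c x.

Definition tspace x : set tvec := [set v |
  (forall c c', chart_at x c -> chart_at x c' ->
     v c' = 'd (ccoord c' \o cparam c) (ccoord c x) (v c)) /\
  (forall c, ~ chart_at x c -> v c = 0)].

Definition local_expr (X : M -> tvec) c : 'rV[R]_m -> 'rV[R]_m :=
  fun z => X (cparam c z) c.

Definition vfield_C1 W (X : M -> tvec) :=
  [/\ open W, (forall y, W y -> tspace y (X y)) &
   forall c, atlas c -> C1_on (ccoord c @` (cdom c `&` W)) (local_expr X c)].

Definition lie_bracket (X Y : M -> tvec) x : tvec := fun c =>
  if `[< chart_at x c >] then
    'd (local_expr Y c) (ccoord c x) (X x c) -
    'd (local_expr X c) (ccoord c x) (Y x c)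
  else 0.

Definition some_chart x : chart R m M := projT1 (cid (atlas_cover x)).

(* The differential of f at x; the component of the image in the chart c' is
   computed from the component of v in some chart c at x. *)
Definition tdiff (f : M -> M) x (v : tvec) : tvec := fun c' =>
  let c := some_chart x in
  if `[< chart_at (f x) c' >] then
    'd (ccoord c' \o f \o cparam c) (ccoord c x) (v c)
  else 0.

(* The fibers of a subbundle K of TM are given as a family K : M -> set tvec. *)
Definition subbundle_C1 (k : nat) (K : M -> set tvec) := forall x,
  exists (W : set M) (E : 'I_k -> M -> tvec),
    [/\ W x, (forall i, vfield_C1 W (E i)) &
     forall y, W y ->
       K y = [set v | exists a : 'I_k -> R, v = \sum_i a i *: E i y] /\
       (forall a : 'I_k -> R,
          \sum_i a i *: E i y = 0 -> forall i, a i = 0)].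

Definition tangent_section (K : M -> set tvec) W (X : M -> tvec) :=
  forall y, W y -> K y (X y).

Section Submanifold.
Variables (N : set M) (n : nat).

Definition slice_chart c := atlas c /\ forall y, cdom c y ->
  (N y <-> forall j : 'I_m, (n <= j)%N -> ccoord c y ord0 j = 0).

Definition submanifold_C2 := (n <= m)%N /\
  forall x, N x -> exists c, slice_chart c /\ cdom c x.

Definition tspace_sub x : set tvec := [set v | tspace x v /\
  forall c, slice_chart c -> cdom c x ->
    forall j : 'I_m, (n <= j)%N -> v c ord0 j = 0].

(* The elements of the fiber of T_N M = TM|_N / TN at x are realized as cosets
   of T_x N in T_x M; the coset of 0 is the zero of the fiber. *)
Definition ncls x (v : tvec) : set tvec :=
  [set w | tspace x w /\ tspace_sub x (w - v)].

Definition normal_fiber x : set (set tvec) :=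
  [set ncls x v | v in tspace x].

(* A section eta of T_N M assigns a coset to each point of N. *)
Definition represents W (Y : M -> tvec) (eta : M -> set tvec) :=
  forall y, W y -> N y -> eta y = ncls y (Y y).

Variable K : M -> set tvec.

(* The union, over all the admissible choices of the extensions Xt and Yt, of
   the classes [Xt, Yt](x) mod T_x N.  When the class does not depend on the
   choices, this is that class. *)
Definition nabla x (X : tvec) (eta : M -> set tvec) : set tvec :=
  [set u | exists (W : set M) (Xt Yt : M -> tvec),
    [/\ W x, vfield_C1 W Xt /\ vfield_C1 W Yt,
        tangent_section K W Xt /\ Xt x = X,
        represents W Yt eta &
        ncls x (lie_bracket Xt Yt x) u]].

Definition velocity (I : set R) (g : R -> M) (t : R) (v : tvec) :=
  [/\ g @ within I (nbhs t) --> g t, tspace (g t) v &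
   forall c, chart_at (g t) c -> deriv_within I (ccoord c \o g) t (v c)].

(* Covariant derivative at t of a section eta of T_N M along the curve g, that
   is, for the connection pulled back by g.  Writing eta near t as
   \sum_i a_i (s_i \o g) with local sections s_i of T_N M represented by C^1
   vector fields Y_i, it is
     \sum_i (a_i'(t) s_i(g t) + a_i(t) nabla_(g'(t)) s_i).
   As for nabla, the union over all the choices is taken. *)
Definition nabla_along (I : set R) (g : R -> M) (eta : R -> set tvec) (t : R) :
    set tvec :=
  [set u | exists (V : tvec) (p : nat) (W : set M) (Y : 'I_p -> M -> tvec)
      (a : 'I_p -> R -> R) (a' : 'I_p -> R) (w : 'I_p -> tvec),
    [/\ velocity I g t V /\ W (g t),
        (forall i, vfield_C1 W (Y i)) /\
          (forall i, deriv_within I (a i : R -> R^o) t (a' i)),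
        (\forall s \near within I (nbhs t),
           eta s = ncls (g s) (\sum_i a i s *: Y i (g s))),
        (forall i, nabla (g t) V (fun y => ncls y (Y i y)) (w i)) &
        ncls (g t) (\sum_i (a' i *: Y i (g t) + a i t *: w i)) u]].

Definition horizontal_lift (I : set R) (g : R -> M) (eta : R -> set tvec) :=
  forall t, I t ->
    normal_fiber (g t) (eta t) /\ nabla_along I g eta t = ncls (g t) 0.

(* The graph of the parallel translation from t0 to t1 along the curve g
   defined on the interval I. *)
Definition parallel_translation (I : set R) (g : R -> M) (t0 t1 : R)
    (z0 z1 : set tvec) :=
  exists eta, [/\ horizontal_lift I g eta, eta t0 = z0 & eta t1 = z1].

(* The same for the curve g on [t 0, t p], smooth on each [t i, t i.+1]: the
   composition of the parallel translations along the pieces. *)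
Definition pw_parallel_translation (p : nat) (t : nat -> R) (g : R -> M)
    (z0 z1 : set tvec) :=
  exists z : nat -> set tvec, [/\ z 0%N = z0, z p = z1 &
    forall i, (i < p)%N ->
      parallel_translation (segment (t i) (t i.+1)) g (t i) (t i.+1)
        (z i) (z i.+1)].

(* f maps x1 to x2, its differential at x1 maps T_x1 N to T_x2 N, and P is the
   graph of the linear map which it induces on the fibers of T_N M. *)
Definition induced_normal_map (f : M -> M) x1 x2
    (P : set tvec -> set tvec -> Prop) :=
  [/\ f x1 = x2,
     (forall v, tspace_sub x1 v -> tspace_sub x2 (tdiff f x1 v)) &
     forall v, tspace x1 v ->
       forall z, P (ncls x1 v) z <-> z = ncls x2 (tdiff f x1 v)].

End Submanifold.

(* phi is a local flow of the vector field X on W, with domain D : the map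
   (t, x) |-> X_t(x) = phi t x is of class C^1 on the open set D of R x M, and
   s |-> phi s x is an integral curve of X starting at x. *)
Definition local_flow W (X : M -> tvec) (D : set (R * M)) (phi : R -> M -> M) :=
  [/\ open D,
      (forall t x s, D (t, x) -> segment 0 t s -> D (s, x)),
      (forall x, D (0, x) -> phi 0 x = x),
      (forall t x, D (t, x) -> W (phi t x) /\
         velocity [set s | D (s, x)] (phi ^~ x) t (X (phi t x))) &
      (forall q, D q -> {for q, continuous (fun q : R * M => phi q.1 q.2)}) /\
      (forall c c', atlas c -> atlas c' ->
         C1_on [set q : R^o * 'rV[R]_m |
                  [/\ (ccoord c @` cdom c) q.2, D (q.1, cparam c q.2) &
                      cdom c' (phi q.1 (cparam c q.2))]]
               (fun q : R^o * 'rV[R]_m =>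
                  ccoord c' (phi q.1 (cparam c q.2))))].

(* The composition of the flows phi i during the times t i.+1 - t i, i < p. *)
Fixpoint composed_flow (phi : nat -> R -> M -> M) (t : nat -> R) (p : nat) x :
    M :=
  if p is p'.+1 then phi p' (t p'.+1 - t p') (composed_flow phi t p' x) else x.

End Geometry.

(* Main.v *)
(* In a slice chart around a point of N, a section of T_N M along the curve is
   represented by the normal components h of a vector field along it.  Since X
   and every other section of K is tangent to N along N, the normal components
   of DX(v) depend only on those of v, and those of the derivative at x of a
   section of K depend only on its value at x.  Hence the condition
   nabla_{g'} eta = 0 amounts to the linear equation h' = (DX h)^normal.
   The differential of the flow satisfies the equation of variation
   w' = DX w, so that the classes of w solve this equation; they are all the
   solutions, as solutions of a linear equation are unique. *)
Require Import Defs.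
From mathcomp Require Import all_boot all_order all_algebra.
From mathcomp Require Import all_classical all_reals all_analysis.
From mathcomp Require Import lra.
Import Order.TTheory GRing.Theory Num.Theory.
Import numFieldNormedType.Exports.
Local Open Scope classical_set_scope.
Local Open Scope ring_scope.
Set Implicit Arguments.
Unset Strict Implicit.
Unset Printing Implicit Defensive.

(** * Derivatives *)

Section DerivWithin.
Context {R : realType}.
Implicit Types (V W : normedModType R) (I J : set R) (t : R).

(** The obstacle is the low regularity. [X] and its flow are only C1, so the flow has no second
    derivatives to interchange, and the equation of variation is obtained from Peano's form of the
    symmetry. Likewise, two sections of [K] that agree at [x] are compared in a merely C1 frame of
    [K]: their difference quotients along a line lie in nearby fibers of [K], so the limit lies in
    the fiber at [x]. As [nabla] and [nabla_along] are unions over all choices, a statement about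
    them has two halves. Every member is shown to have the expected normal components in a slice
    chart, which is the independence of the choices; and one choice has to be exhibited, for which
    the coordinate fields of a slice chart serve. Their brackets with [X] must be tangent vectors,
    which rests on the symmetry of the second derivatives of the chart transitions. No existence
    theorem for differential equations enters: the differential of the flow provides the lifts.
    Uniqueness is proved locally in slice charts and spread over the whole interval by
    connectedness. *)

Lemma diff_approx V W (f : V -> W) x (e : R) : differentiable f x -> 0 < e ->
  \forall y \near x, `|f y - f x - 'd f x (y - x)| <= e * `|y - x|.
Proof.
move=> /diff_locally/eqaddoP fx e0.
rewrite (near_shift 0 x) /=; have := fx _ e0.
apply: filterS => y; rewrite /= !fctE /= subr0 addrK opprD addrA; exact.
Qed.

Lemma nbhs_within_dnbhs I t : within I t^' `=>` nbhs t.
Proof. by move=> A /nbhs_dnbhs At; apply: filterS At => s As _. Qed.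

Lemma deriv_within_cvg V I (g : R -> V) t v :
  deriv_within I g t v -> g @ within I t^' --> g t.
Proof.
move=> gv.
have dt : (s - t) @[s --> within I t^'] --> (0 : R).
  have dt0 : (s - t) @[s --> t] --> (0 : R).
    by rewrite -[X in _ --> X](subrr t); apply: (@cvgB R R^o);
      [exact: cvg_id|exact: cvg_cst].
  by move=> A /dt0 At; exact: nbhs_within_dnbhs.
rewrite -[X in _ --> X]addr0 -(scale0r v).
have gl : (g t + (s - t) *: ((s - t)^-1 *: (g s - g t)))
    @[s --> within I t^'] --> g t + 0 *: v.
  by apply: cvgD; [exact: cvg_cst|exact: cvgZ].
apply: cvg_trans gl.
apply: near_eq_cvg; rewrite /= !near_withinE near_simpl; near=> s => st _ /=.
rewrite scalerA divff ?scale1r ?[g t + _]addrC ?subrK // subr_eq0.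
Unshelve. all: by end_near. Qed.

Lemma deriv_within_comp V W I (g : R -> V) t v (f : V -> W) :
  deriv_within I g t v -> differentiable f (g t) ->
  deriv_within I (f \o g) t ('d f (g t) v).
Proof.
move=> gv df; have gc := deriv_within_cvg gv.
apply/cvgrPdist_le => e e0.
(* [c] bounds the difference quotients of [g] near [t], and [h * c = e / 2]: the remainder of [f] at
   [g s], divided by [s - t], then contributes at most half of [e]. *)
pose c := `|v| + 1; have c0 : 0 < c by rewrite ltr_wpDl.
pose h := e / 2 / c; have h0 : 0 < h by rewrite !divr_gt0.
have dfv : 'd f (g t) ((s - t)^-1 *: (g s - g t)) @[s --> within I t^']
   --> 'd f (g t) v.
  by apply: continuous_cvg gv; exact: diff_continuous.
move/cvgrPdist_le : dfv => /(_ (e / 2)) dfv.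
have near1 : \forall s \near within I t^', `|(s - t)^-1 *: (g s - g t)| <= c.
  move/cvgrPdist_le : gv => /(_ 1 ltr01); apply: filterS => s /= vs.
  rewrite -[X in `|X|](subKr v) (le_trans (ler_normB _ _)) // lerD2l //.
have near2 : \forall s \near within I t^',
    `|f (g s) - f (g t) - 'd f (g t) (g s - g t)| <= h * `|g s - g t|.
  exact: (gc _ (diff_approx df h0)).
near=> s.
rewrite [e]splitr -(subrKA ('d f (g t) ((s - t)^-1 *: (g s - g t)))).
apply: le_trans (ler_normD _ _) _; apply: lerD.
  by near: s; apply: dfv; rewrite divr_gt0.
rewrite linearZ /= -scalerBr normrZ distrC.
apply: (@le_trans _ _ (`|(s - t)^-1| * (h * `|g s - g t|))).
  by rewrite ler_wpM2l //; near: s; exact: near2.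
rewrite mulrCA -normrZ -(divfK (lt0r_neq0 c0) (e / 2)) ler_pM2l //.
by near: s; exact: near1.
Unshelve. all: by end_near. Qed.

Lemma deriv_within_unique V I (g : R -> V) t v v' :
  ProperFilter (within I t^') ->
  deriv_within I g t v -> deriv_within I g t v' -> v = v'.
Proof. by move=> FF; apply: cvg_unique; exact: norm_hausdorff. Qed.

Lemma sub_deriv_within V I J (g : R -> V) t v : I `<=` J ->
  deriv_within J g t v -> deriv_within I g t v.
Proof.
move=> IJ gv A /gv Av.
by apply: (@filterS _ t^' _ _ _ _ Av) => s As /IJ /As.
Qed.

Lemma near_eq_deriv_within V I (f g : R -> V) t v : I t ->
  (\forall s \near within I (nbhs t), f s = g s) ->
  deriv_within I f t v -> deriv_within I g t v.
Proof.
move=> It fg; have fgt : f t = g t by exact: (nbhs_singleton fg It).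
apply: cvg_trans; apply: near_eq_cvg.
have : within I t^' (fun s => f s = g s) by exact: nbhs_dnbhs fg.
by apply: filterS => s /= ->; rewrite fgt.
Qed.

Lemma deriv_within_cst V I (v : V) t : deriv_within I (fun=> v) t 0.
Proof.
rewrite /deriv_within [X in X @ _](_ : _ = fun=> 0); first exact: cvg_cst.
by apply/funext => s; rewrite subrr scaler0.
Qed.

Lemma deriv_withinD V I (f g : R -> V) t v w :
  deriv_within I f t v -> deriv_within I g t w ->
  deriv_within I (fun s => f s + g s) t (v + w).
Proof.
move=> fv gw; rewrite /deriv_within.
rewrite [X in X @ _](_ : _ =
  fun s => (s - t)^-1 *: (f s - f t) + (s - t)^-1 *: (g s - g t)).
  exact: cvgD.
by apply/funext => s; rewrite -scalerDr opprD addrACA.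
Qed.

Lemma deriv_within_sum V I (T : Type) (r : seq T) (f : T -> R -> V) t v :
  (forall i, deriv_within I (f i) t (v i)) ->
  deriv_within I (fun s => \sum_(i <- r) f i s) t (\sum_(i <- r) v i).
Proof.
move=> fv; elim: r => [|i r IH].
  rewrite big_nil [X in deriv_within _ X](_ : _ = fun=> 0).
    exact: deriv_within_cst.
  by apply/funext => s; rewrite big_nil.
rewrite big_cons [X in deriv_within _ X](_ : _ =
  fun s => f i s + \sum_(j <- r) f j s); first exact: deriv_withinD.
by apply/funext => s; rewrite big_cons.
Qed.

Lemma deriv_withinZ V I (a : R -> R^o) (f : R -> V) t a' v :
  deriv_within I a t a' -> deriv_within I f t v ->
  deriv_within I (fun s => a s *: f s) t (a' *: f t + a t *: v).
Proof.
move=> aa fv; rewrite /deriv_within.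
rewrite [X in X @ _](_ : _ = fun s =>
  ((s - t)^-1 *: (a s - a t)) *: f s + a t *: ((s - t)^-1 *: (f s - f t))).
  apply: cvgD; last by apply: cvgZ => //; exact: cvg_cst.
  apply: cvgZ => //; exact: deriv_within_cvg fv.
apply/funext => s; have mE (b : R^o) (w : V) : ((s - t)^-1 *: b) *: w = (s - t)^-1 *: (b *: w).
  by rewrite scalerA.
rewrite !scalerBr !(scalerA (a t)) mulrC -!scalerA scalerBl !mE.
by rewrite addrA subrK.
Qed.

Lemma deriv_withinB V I (f g : R -> V) t v w :
  deriv_within I f t v -> deriv_within I g t w ->
  deriv_within I (fun s => f s - g s) t (v - w).
Proof.
move=> fv gw; rewrite /deriv_within.
rewrite [X in X @ _](_ : _ =
  fun s => (s - t)^-1 *: (f s - f t) - (s - t)^-1 *: (g s - g t)).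
  exact: cvgB.
by apply/funext => s; rewrite -scalerBr !opprD !opprK addrACA.
Qed.

Lemma deriv_within_line V I (z v : V) t :
  deriv_within I (fun s => z + s *: v) t v.
Proof.
have {2}-> : v = 0 + (1 *: v + t *: 0) by rewrite scale1r scaler0 addr0 add0r.
apply: deriv_withinD; first exact: deriv_within_cst.
apply: (@deriv_withinZ _ _ (fun s => s) (fun=> v) _ 1 0); last exact: deriv_within_cst.
apply: cvg_near_cst; have : within I t^' (fun s => s != t).
  exact: (@filterE _ (nbhs t) _ (fun s => s != t -> I s -> s != t)).
by apply: filterS => s st; rewrite [LHS]mulVf // subr_eq0.
Qed.

Lemma dnbhs_shift t (P : set R) : t^' P <-> 0^' (fun h => P (h + t)).
Proof.
rewrite /dnbhs /within /=; have := @near_shift _ R 0 t (fun s => s != t -> P s).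
rewrite /= /prop_near1 /= => E; rewrite [X in X <-> _]E subr0.
split; apply: filterS => s /= As.
  by move=> s0; apply: As; rewrite -subr_eq0 addrK.
by rewrite -subr_eq0 addrK.
Qed.

(** The bridge to the mean value theorem, which is stated with two-sided derivatives. *)
Lemma deriv_within_is_derive V I (g : R -> V) t v :
  nbhs t I -> deriv_within I g t v -> is_derive t (1 : R^o) (g : R^o -> V) v.
Proof.
move=> It gv.
have gv' : (s - t)^-1 *: (g s - g t) @[s --> t^'] --> v.
  move=> A /gv Av; have : t^' I by exact: nbhs_dnbhs.
  move=> tI; have Av' : t^' (fun s => I s -> A ((s - t)^-1 *: (g s - g t))) := Av.
  by apply: (@filterS2 _ t^' _ _ _ _ _ tI Av') => s Is /(_ Is).
have H : h^-1 *: ((g \o shift t) (h *: (1 : R^o)) - g t) @[h --> 0^'] --> v.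
  move=> A /gv' /dnbhs_shift; apply: filterS => h.
  by rewrite /= addrK [h%:A]mulr1.
apply: DeriveDef; last exact/cvg_lim.
by apply/cvg_ex; exists v.
Qed.

Lemma is_derive_deriv_within V I (g : R -> V) t v :
  is_derive t (1 : R^o) (g : R^o -> V) v -> deriv_within I g t v.
Proof.
case=> dg gv.
have H : h^-1 *: ((g \o shift t) (h *: (1 : R^o)) - g t) @[h --> 0^'] --> v.
  by rewrite -gv; exact: dg.
move=> A /H Ah; have : t^' (fun s => A ((s - t)^-1 *: (g s - g t))).
  apply/dnbhs_shift; apply: (@filterS _ (0:R)^' _ _ _ _ Ah) => h.
  by rewrite /= addrK [h%:A]mulr1.
by apply: (@filterS _ t^') => s As _.
Qed.

End DerivWithin.

(** * Differentials and maps of class C1 *)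

Section Differentials.
Context {R : realType}.
Implicit Types (V W : normedModType R).

Lemma near_eq_diff V W (f g : V -> W) x : (\forall y \near x, f y = g y) ->
  differentiable f x -> differentiable g x /\ 'd g x = 'd f x :> (V -> W).
Proof.
move=> fg df; have fgx : f x = g x := nbhs_singleton fg.
have H : g \o shift x = cst (g x) + 'd f x +o_ 0 id.
  apply/eqaddoP => e e0; move/diff_locally/eqaddoP : (df) => /(_ e e0).
  move: fg; rewrite (near_shift 0 x) subr0 => fg.
  by apply: filterS2 fg => y /= fgy; rewrite !fctE /= fgy fgx.
have dc : continuous ('d f x) by exact: diff_continuous.
have gE := diff_unique dc H; split; last exact: gE.
by apply/diff_locallyP; rewrite gE.
Qed.

Lemma C1_on_near_eq V W (A : set V) (f g : V -> W) : open A ->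
  {in A, f =1 g} -> C1_on A f -> C1_on A g.
Proof.
move=> oA fg Cf x Ax.
have nfg y : A y -> \forall z \near y, f z = g z.
  by move=> Ay; apply: filterS (open_nbhs_nbhs (conj oA Ay)) => z Az; apply/fg/mem_set.
have [df cf] := Cf x Ax; have [dg dgE] := near_eq_diff (nfg x Ax) df.
split; first exact: dg.
move=> v; suff : 'd g y v @[y --> x] --> 'd f x v by rewrite -dgE.
apply: cvg_trans (cf v); apply: near_eq_cvg.
apply: filterS (open_nbhs_nbhs (conj oA Ax)) => y Ay.
have [dfy _] := Cf y Ay; by have [_ ->] := near_eq_diff (nfg y Ay) dfy.
Qed.

Lemma linear_joint_cvg m W (D : 'rV[R]_m -> {linear 'rV[R]_m -> W}) T
    (F : set_system T) (FF : Filter F) (g u : T -> 'rV[R]_m) z u0 :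
  (forall v, D y v @[y --> z] --> D z v) -> g @ F --> z -> u @ F --> u0 ->
  D (g s) (u s) @[s --> F] --> D z u0.
Proof.
move=> cD gz uu0.
have E y v : D y v = \sum_j v 0 j *: D y (delta_mx 0 j).
  rewrite {1}[v]row_sum_delta linear_sum; apply: eq_bigr => j _.
  by rewrite linearZ.
rewrite (E z u0).
have -> : (fun s => D (g s) (u s)) =
    fun s => \sum_j u s 0 j *: D (g s) (delta_mx 0 j) by apply/funext => s.
apply: (cvg_big add_continuous) => j _.
apply: cvgZ; last exact: cvg_comp gz (cD _).
exact: (cvg_comp _ (fun M : 'rV_m => M 0 j) uu0 (@coord_continuous R 1 m 0 j u0)).
Qed.

Lemma diff_joint_cvg m W (f : 'rV[R]_m -> W) T (F : set_system T)
    (FF : Filter F) (g u : T -> 'rV[R]_m) z u0 :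
  (forall v, {for z, continuous (fun y => 'd f y v)}) ->
  g @ F --> z -> u @ F --> u0 ->
  'd f (g s) (u s) @[s --> F] --> 'd f z u0.
Proof.
move=> cf; apply: (@linear_joint_cvg _ _ (fun y => 'd f y)); exact: cf.
Qed.

Lemma C1_on_comp m V W (A : set V) (B : set 'rV[R]_m) (g : V -> 'rV[R]_m)
    (f : 'rV[R]_m -> W) : open A -> (forall x, A x -> B (g x)) ->
  C1_on A g -> C1_on B f -> C1_on A (f \o g).
Proof.
move=> oA AB Cg Cf x Ax; have [dg cg] := Cg x Ax; have [df cf] := Cf _ (AB x Ax).
split; first exact: differentiable_comp.
move=> v; rewrite /prop_for /continuous_at (diff_comp dg df).
have : 'd f (g y) ('d g y v) @[y --> x] --> 'd f (g x) ('d g x v).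
  apply: diff_joint_cvg => //; first exact: differentiable_continuous.
  exact: cg.
apply: cvg_trans; apply: near_eq_cvg.
apply: filterS (open_nbhs_nbhs (conj oA Ax)) => y Ay.
have [dgy _] := Cg y Ay; have [dfy _] := Cf _ (AB y Ay).
by rewrite (diff_comp dgy dfy).
Qed.

Lemma deriv_within_near_continuous V I (g : R -> V) t v :
  deriv_within I g t v -> g @ within I (nbhs t) --> g t.
Proof.
move=> gv A At; have Ad : within I t^' (g @^-1` A) by exact: deriv_within_cvg gv _ At.
apply: (@filterS _ (nbhs t) _ _ _ _ Ad) => s As Is.
have [->|/As] := eqVneq s t; first exact: nbhs_singleton At.
exact.
Qed.

Lemma deriv_within_coord I p q (g : R -> 'M[R]_(p, q)) t v i j :
  deriv_within I g t v -> deriv_within I (fun s => g s i j : R^o) t (v i j).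
Proof.
move=> gv; rewrite /deriv_within [X in X @ _](_ : _ =
  fun s => ((s - t)^-1 *: (g s - g t)) i j).
  exact: (@cvg_comp _ _ _ _ (fun M : 'M[R]_(p, q) => M i j) _ _ _ gv
    (@coord_continuous R p q i j v)).
by apply/funext => s; rewrite !mxE.
Qed.

Lemma deriv_within_row I p (g : R -> 'rV[R]_p) t (v : 'rV[R]_p) :
  (forall j, deriv_within I (fun s => g s 0 j : R^o) t (v 0 j)) ->
  deriv_within I g t v.
Proof.
move=> gv; rewrite [v]row_sum_delta.
rewrite (_ : g = fun s => \sum_j g s 0 j *: delta_mx 0 j); last first.
  by apply/funext => s; exact: row_sum_delta.
apply: deriv_within_sum => j.
rewrite -[v 0 j *: _]addr0 -(scaler0 _ (g t 0 j)).
by apply: deriv_withinZ => //; exact: deriv_within_cst.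
Qed.

End Differentials.

(** * Limits and connectedness on segments *)

Section Segments.
Context {R : realType}.

Lemma segmentE (a b : R) :
  segment a b = `[Num.min a b, Num.max a b]%classic.
Proof. by apply/seteqP; split => s /=; rewrite in_itv. Qed.

Lemma segment_left (a b : R) : segment a b a.
Proof. by rewrite /segment /= ge_min le_max lexx. Qed.

Lemma segment_right (a b : R) : segment a b b.
Proof. by rewrite /segment /= ge_min le_max lexx !orbT. Qed.

(** Makes derivatives within the segment unique, also at its endpoints. *)
Lemma segment_proper (a b t : R) : a != b -> segment a b t ->
  ProperFilter (within (segment a b) t^').
Proof.
move=> ab; rewrite /segment /=; set lo := Num.min a b; set hi := Num.max a b.
have lohi : lo < hi.
  rewrite /lo /hi; move: ab; rewrite neq_lt => /orP[] h.
    by rewrite min_l ?max_r // ltW.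
  by rewrite min_r ?max_l // ltW.
move=> /andP[lot thi]; apply: Build_ProperFilter_ex => A.
move=> /nbhs_ballP[e /= e0 eA].
(* The witness lies at distance at most [e / 2] to the right of [t], or to the left when [t] is the
   upper end. *)
have [thi'|hit] := ltP t hi.
  exists (Num.min (t + e / 2) hi).
  have tm : t < Num.min (t + e / 2) hi by rewrite lt_min thi' ltrDl divr_gt0.
  apply: eA; [|by rewrite gt_eqF|].
    rewrite /ball /= ltr0_norm ?subr_lt0 // opprB ltrBlDl gt_min.
    by rewrite ltrD2l ltr_pdivrMr // ltr_pMr // ltr1n.
  rewrite /= -/lo -/hi; apply/andP; split; last by rewrite ge_min lexx orbT.
  by rewrite (le_trans lot) // ltW.
exists (Num.max (t - e / 2) lo).
have tm : Num.max (t - e / 2) lo < t.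
  by rewrite gt_max (lt_le_trans lohi) // andbT gtrBl divr_gt0.
apply: eA; [|by rewrite lt_eqF|].
  rewrite /ball /= gtr0_norm ?subr_gt0 // ltrBlDr -ltrBlDl lt_max.
  by rewrite ltrD2l ltrN2 ltr_pdivrMr // ltr_pMr // ltr1n.
rewrite /= -/lo -/hi; apply/andP; split; first by rewrite le_max lexx orbT.
by rewrite (le_trans _ thi) // ltW.
Qed.

(** The segment is connected, and the points where [P] holds form a subset that is both relatively
    open and relatively closed. *)
Lemma segment_locally_constant (a b : R) (P : R -> Prop) :
  (forall t, segment a b t ->
    \forall s \near within (segment a b) (nbhs t), P s <-> P t) ->
  P a -> forall s, segment a b s -> P s.
Proof.
move=> Pn Pa.
suff : segment a b `&` [set s | P s] = segment a b.
  by move=> E s Is; have [] // : (segment a b `&` [set s | P s]) s by rewrite E.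
rewrite segmentE; apply: segment_connected.
by exists a; split => //; rewrite -segmentE; exact: segment_left.
(* Adjoining the complement of the segment before taking the interior makes the relatively open set
   the trace of an open set; the closed set below arises likewise from the negation of [P]. *)
exists (interior (~` segment a b `|` [set s | P s])).
    exact: open_interior.
  rewrite -segmentE; apply/seteqP; split => s [Is Ps]; split => //.
    apply: (@filterS _ (nbhs s) _ _ _ _ (Pn s Is)) => u Pu.
    by have [Iu|] := pselect (segment a b u); [right; apply/Pu|left].
  by have [|] := nbhs_singleton Ps.
exists (~` interior (~` segment a b `|` ~` [set s | P s])).
  by apply: open_closedC; exact: open_interior.
rewrite -segmentE; apply/seteqP; split => s [Is Ps]; split => //.
  by move=> /nbhs_singleton[|] /=; apply.
apply: contrapT => nPs; apply: Ps.
apply: (@filterS _ (nbhs s) _ _ _ _ (Pn s Is)) => u Pu.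
by have [Iu|] := pselect (segment a b u); [right => /(Pu Iu)|left].
Qed.

End Segments.

(** * The mean value theorem and mixed derivatives *)

Section MeanValue.
Context {R : realType}.

(** The order of [a] and [b] is left free and [c] is only located in the ball, so that increments of
    either sign can be treated at once. *)
Lemma MVT_ball (f df : R -> R^o) (t d : R) :
  (forall x, `|x - t| < d -> deriv_within setT f x (df x)) ->
  forall a b, `|a - t| < d -> `|b - t| < d ->
  exists2 c, `|c - t| < d & f b - f a = df c * (b - a).
Proof.
move=> fd.
have H a b : a < b -> `|a - t| < d -> `|b - t| < d ->
    exists2 c, `|c - t| < d & f b - f a = df c * (b - a).
  move=> ab ad bd.
  have cd c : a <= c <= b -> `|c - t| < d.
    move: ad bd; rewrite !ltr_distl => /andP[ad _] /andP[_ bd] /andP[ac cb].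
    by rewrite (lt_le_trans ad) // (le_lt_trans cb).
  have fd' c : a <= c <= b -> is_derive c (1 : R^o) (f : R^o -> R^o) (df c).
    move=> /cd /fd; apply: deriv_within_is_derive; exact: filterT.
  have [c cab fE] : exists2 c, c \in `]a, b[%R & f b - f a = df c * (b - a).
    apply: MVT => //.
      move=> x; rewrite in_itv /= => /andP[ax xb]; apply: fd'.
      by rewrite !ltW.
    apply: derivable_within_continuous => x; rewrite in_itv /= => xab.
    by have [] := fd' x xab.
  exists c => //; apply: cd; move: cab; rewrite in_itv /= => /andP[ax xb].
  by rewrite !ltW.
move=> a b ad bd; have [ab|ba|->] := ltgtP a b; first exact: H.
  have [c cd fE] := H _ _ ba bd ad; exists c => //.
  by rewrite -opprB fE -mulrN opprB.
by exists b => //; rewrite !subrr mulr0.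
Qed.

(* Peano's form of the symmetry of second derivatives: only one of the two
   mixed derivatives of G is assumed to exist. *)
Lemma mixed_derivative I (G Q Qr : R -> R -> R^o) (Gr : R -> R^o) t :
  (\forall q \near ((t, 0) : R * R),
     deriv_within setT (fun s => G s q.2) q.1 (Q q.1 q.2) /\
     deriv_within setT (Q q.1) q.2 (Qr q.1 q.2)) ->
  (\forall s \near t, deriv_within setT (G s) 0 (Gr s)) ->
  (fun q : R * R => Qr q.1 q.2) @ (t, 0) --> Qr t 0 ->
  deriv_within I Gr t (Qr t 0).
Proof.
move=> GQ GGr Qrc; apply/cvgrPdist_le => e e0.
have [d d0 dH] : exists2 d, 0 < d & forall s r, `|s - t| < d -> `|r - 0| < d ->
   [/\ deriv_within setT (fun s => G s r) s (Q s r),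
     deriv_within setT (Q s) r (Qr s r), `|Qr t 0 - Qr s r| <= e &
     deriv_within setT (G s) 0 (Gr s)].
  have Qre : \forall q \near ((t, 0) : R * R), `|Qr t 0 - Qr q.1 q.2| <= e.
    exact: (cvgrPdist_le _ _).1 Qrc e e0.
  have [d1 /= d10 H1] := (nbhs_ballP ((t, 0) : R * R) _).1 (filterI GQ Qre).
  have [d2 /= d20 H2] := (nbhs_ballP t _).1 GGr.
  exists (Num.min d1 d2); first by rewrite lt_min d10.
  move=> s r; rewrite !lt_min => /andP[s1 s2] /andP[r1 r2].
  have [] := H1 (s, r); first by split; rewrite /ball /= distrC.
  move=> [/= A B] C; split => //.
  by apply: H2; rewrite /ball /= distrC.
have near_t : within I t^' (fun s => `|s - t| < d /\ s != t).
  have : \forall s \near t, `|s - t| < d.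
    by apply/nbhs_ballP; exists d => // s; rewrite /ball /= distrC.
  by apply: (@filterS _ (nbhs t)) => s ? ? ?; split.
apply: filterS near_t => s [sd st]; apply/ler_addgt0Pr => h h0.
have st0 : s - t != 0 by rewrite subr_eq0.
have td : `|t - t| < d by rewrite subrr normr0.
have d00 : `|0 - 0 : R| < d by rewrite subrr normr0.
have [_ _ _ Gs] := dH s 0 sd d00; have [_ _ _ Gt] := dH t 0 td d00.
have /cvgrPdist_le H := deriv_withinB Gs Gt.
have hs : 0 < h * `|s - t| by rewrite mulr_gt0 // normr_gt0.
(* For fixed [s], a small [r] brings the second difference of [G] divided by [r] close to
   [Gr s - Gr t]; the error is taken proportional to the distance from [s] to [t] because everything
   is divided by [s - t] at the end. *)
have [r [rd r0 Hr]] : exists r, [/\ `|r - 0| < d, r != 0 &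
    `|Gr s - Gr t - r^-1 * (G s r - G t r - (G s 0 - G t 0))| <= h * `|s - t|].
  have near0 : within setT (0 : R)^' (fun r => `|r - 0| < d /\ r != 0).
    have : \forall r \near (0 : R), `|r - 0| < d.
      by apply/nbhs_ballP; exists d => // r; rewrite /ball /= distrC.
    by apply: (@filterS _ (nbhs (0 : R))) => r ? ? ?; split.
  have PF : ProperFilter (within setT (0 : R)^').
    apply: (@Build_ProperFilter _ _ _) => W0.
    apply: (@filter_not_empty _ (0 : R)^' _).
    by apply: (@filterS _ (nbhs (0 : R))) W0 => r /= A B; exact: A.
  have [r [[rd r0] Hr]] := @filter_ex _ _ PF _ (filterI near0 (H _ hs)).
  exists r; split => //; apply: le_trans Hr; rewrite le_eqVlt; apply/orP; left.
  by rewrite subr0.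
(* By the mean value theorem in [s], then in [r], the same second difference is a value of [Qr] near
   [(t, 0)] times [r * (s - t)]. *)
have [c cd cE] : exists2 c, `|c - t| < d &
   (G s r - G s 0) - (G t r - G t 0) = (Q c r - Q c 0) * (s - t).
  apply: (@MVT_ball (fun s => G s r - G s 0) (fun s => Q s r - Q s 0) t d) => //.
  move=> x xd; have [? _ _ _] := dH x r xd rd; have [? _ _ _] := dH x 0 xd d00.
  exact: deriv_withinB.
have [b bd bE] : exists2 b, `|b - 0| < d & Q c r - Q c 0 = Qr c b * (r - 0).
  by apply: (@MVT_ball (Q c) (Qr c) 0 d) => // x xd; have [] := dH c x cd xd.
have [_ _ Qe _] := dH c b cd bd.
have E : r^-1 * (G s r - G t r - (G s 0 - G t 0)) = Qr c b * (s - t).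
  rewrite opprB addrACA [- G t r + _]addrC.
  rewrite (_ : G s r + _ + _ = (G s r - G s 0) - (G t r - G t 0)); last first.
    by rewrite opprB !addrA [G s r + _ - _]addrAC.
  by rewrite cE bE subr0 mulrAC mulrC mulfK.
rewrite E in Hr.
rewrite -(subrKA (Qr c b)); apply: le_trans (ler_normD _ _) _; apply: lerD => //.
have -> : Qr c b - (s - t)^-1 *: (Gr s - Gr t) =
   - (s - t)^-1 * (Gr s - Gr t - Qr c b * (s - t)).
  by rewrite mulNr mulrBr opprB [_ * (_ * _)]mulrCA mulVf // mulr1.
by rewrite normrM normrN normfV ler_pdivrMl ?normr_gt0 // [_ * h]mulrC.
Qed.

End MeanValue.

(** * Linear differential equations *)

Section Linear.
Context {R : realType}.

Lemma row_norm_le m (x : 'rV[R]_m) e : 0 <= e ->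
  (forall j, `|x 0 j| <= e) -> `|x| <= e.
Proof.
move=> e0 xe; rewrite /Num.Def.normr /= mx_normrE; apply: bigmax_le => // -[i j] _.
by rewrite /= ord1.
Qed.

Lemma coord_norm_le m (x : 'rV[R]_m) j : `|x 0 j| <= `|x|.
Proof.
rewrite [leRHS]/Num.Def.normr /= mx_normrE.
exact: (@le_bigmax _ _ _ 0 (fun ij => `|x ij.1 ij.2|) (0, j)).
Qed.

(* The interval is so short that, by the mean value theorem, the maximum of |d|
   is at most half of itself. *)
Lemma linear_ODE_zero m (lo hi L : R) (d l : R -> 'rV[R]_m) :
  lo <= hi -> 0 <= L -> L * (hi - lo) <= 1 / 2 ->
  (forall s, lo <= s <= hi ->
     deriv_within `[lo, hi]%classic d s (l s) /\ `|l s| <= L * `|d s|) ->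
  forall s0, lo <= s0 <= hi -> d s0 = 0 -> forall s, lo <= s <= hi -> d s = 0.
Proof.
move=> lohi L0 Lsmall dl s0 s0I ds0.
have dI s : lo <= s <= hi -> d @ within `[lo, hi]%classic (nbhs s) --> d s.
  by move=> /dl[ds _]; exact: deriv_within_near_continuous ds.
have dc : {within `[lo, hi], continuous (fun s => `|d s|)}.
  apply/subspace_continuousP => s; rewrite /= in_itv /= => /dI.
  exact: cvg_norm.
have [c] := EVT_max lohi dc; rewrite in_itv /= => cI cmax.
(* As [c] maximizes the norm of [d], each increment is at most [L * (hi - lo)] times that maximum,
   hence at most half of it. Applied between the zero [s0] and [c], this bounds the maximum by its
   own half. *)
have inc a b j : a < b -> lo <= a <= hi -> lo <= b <= hi ->
    `|d b 0 j - d a 0 j| <= 1 / 2 * `|d c|.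
  move=> ab /andP[loa _] /andP[_ bhi].
  have abI x : a <= x <= b -> lo <= x <= hi.
    by move=> /andP[ax xb]; rewrite (le_trans loa) // (le_trans xb).
  have [x] : exists2 x, x \in `]a, b[%R &
      d b 0 j - d a 0 j = l x 0 j * (b - a).
    apply: (@MVT R (fun s => d s 0 j)) => //.
      move=> x; rewrite in_itv /= => /andP[ax xb].
      have [|dx _] := dl x; first by apply: abI; rewrite !ltW.
      apply: (@deriv_within_is_derive _ R^o `[lo, hi]%classic);
        last exact: deriv_within_coord dx.
      have xlh : x \in `]lo, hi[%R.
        by rewrite in_itv /= (le_lt_trans loa) // (lt_le_trans xb).
      apply: filterS (near_in_itvoo xlh) => y /=; rewrite !in_itv /=.
      by move=> /andP[? ?]; rewrite !ltW.
    apply/subspace_continuousP => x; rewrite /= in_itv /= => /abI /dI dx.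
    have dxj : (fun s => d s 0 j) @ within `[lo, hi]%classic (nbhs x) --> d x 0 j.
      exact: (cvg_comp _ (fun M : 'rV_m => M 0 j) dx
        (@coord_continuous R 1 m 0 j (d x))).
    move=> A /dxj; apply: (@filterS _ (nbhs x)) => y Ay; rewrite /= in_itv /=.
    by move=> /abI yI; apply: Ay; rewrite /= in_itv.
  rewrite in_itv /= => /andP[ax xb] ->; rewrite normrM (@gtr0_norm _ (b - a)) ?subr_gt0 //.
  have xI : lo <= x <= hi by apply: abI; rewrite !ltW.
  have [_ lx] := dl x xI.
  apply: (@le_trans _ _ (L * `|d c| * (hi - lo))).
    apply: ler_pM => //; first by rewrite subr_ge0 ltW.
      apply: (le_trans (coord_norm_le _ _)); apply: (le_trans lx).
      by rewrite ler_wpM2l // cmax // in_itv.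
    by rewrite lerB.
  by rewrite mulrAC ler_wpM2r.
suff dc0 : `|d c| <= 1 / 2 * `|d c|.
  have dc00 : `|d c| <= 0.
    move: dc0; rewrite -subr_le0 -{1}(mul1r `|d c|) -mulrBl.
    by rewrite pmulr_rle0 // subr_gt0 mul1r invf_lt1 // ltr1n.
  move=> s sI; apply/eqP; rewrite -normr_le0 (le_trans _ dc00) //; apply: cmax.
  by rewrite in_itv.
apply: row_norm_le => [|j]; first by rewrite mulr_ge0 // divr_ge0.
have s0j : d s0 0 j = 0 by rewrite ds0 mxE.
have [s0c|cs0|<-] := ltgtP s0 c.
- by have := inc _ _ j s0c s0I cI; rewrite s0j subr0.
- by have := inc _ _ j cs0 cI s0I; rewrite s0j sub0r normrN.
- by rewrite s0j normr0 mulr_ge0 // divr_ge0.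
Qed.

Lemma linear_bounded_near m (W : normedModType R)
    (D : 'rV[R]_m -> {linear 'rV[R]_m -> W}) z :
  (forall v, D y v @[y --> z] --> D z v) ->
  exists2 L, 0 <= L & \forall y \near z, forall v, `|D y v| <= L * `|v|.
Proof.
(* The summand 1 leaves room for the variation, near [z], of the value of [D y] at each basis
   vector. *)
move=> cD; exists (\sum_j (`|D z (delta_mx 0 j)| + 1)).
  by apply: sumr_ge0 => j _; rewrite addr_ge0.
have H : \forall y \near z, forall j : 'I_m,
    `|D y (delta_mx 0 j)| <= `|D z (delta_mx 0 j)| + 1.
  apply: (@filter_forall _ _ _ (nbhs z)) => j.
  move/cvgrPdist_le : (cD (delta_mx 0 j)) => /(_ 1 ltr01).
  apply: filterS => y yz; rewrite addrC -lerBlDr.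
  by apply: le_trans (lerB_dist _ _) _; rewrite distrC.
apply: filterS H => y Hy v.
rewrite {1}[v]row_sum_delta linear_sum mulr_suml.
apply: (le_trans (ler_norm_sum _ _ _)); apply: ler_sum => j _.
by rewrite linearZ normrZ mulrC ler_pM // coord_norm_le.
Qed.

End Linear.

(** * Symmetry of second derivatives *)

Section SecondDerivative.
Context {R : realType}.

Lemma setT_proper (t : R) : ProperFilter (within setT t^').
Proof.
apply: (@Build_ProperFilter _ _ _) => W0.
apply: (@filter_not_empty _ t^' _).
by apply: (@filterS _ (nbhs t)) W0 => r /= A B; exact: A.
Qed.

Lemma diff_line (V W : normedModType R) (f : V -> W) (z v y : V) (r : R) :
  y = z + r *: v -> differentiable f y ->
  deriv_within setT (fun s : R => f (z + s *: v)) r ('d f y v).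
Proof.
move=> -> df; apply: (@deriv_within_comp _ V W setT (fun s => z + s *: v) r v f).
  exact: deriv_within_line.
exact: df.
Qed.

Lemma diff_line0 (V W : normedModType R) (f : V -> W) (z v : V) :
  differentiable f z ->
  deriv_within setT (fun s : R => f (z + s *: v)) 0 ('d f z v).
Proof.
by apply: diff_line; rewrite scale0r addr0.
Qed.

Lemma line_cvg (V : normedModType R) (z v : V) : (z + s *: v) @[s --> (0 : R)] --> z.
Proof.
rewrite -[X in _ --> X]addr0 -(scale0r v).
apply: cvgD; first exact: cvg_cst.
by apply: cvgZ; [exact: cvg_id|exact: cvg_cst].
Qed.

Lemma cvg_pair_nbhs (T : Type) (F : set_system T) (FF : Filter F)
    (U V : topologicalType) (f : T -> U) (g : T -> V) a b :
  f @ F --> a -> g @ F --> b -> (fun s => (f s, g s)) @ F --> ((a, b) : U * V).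
Proof. by move=> fa gb; exact: (cvg_pair fa gb). Qed.

(** This is [mixed_derivative] for each coordinate of [f] on the plane [z + s *: u + r *: v]:
    differentiating in [s] and then in [r] agrees with differentiating in [s] the derivative in
    [r]. *)
Lemma C2_diff_sym m p (A : set 'rV[R]_m) (f : 'rV[R]_m -> 'rV[R]_p) z u v :
  open A -> C2_on A f -> A z ->
  'd (fun y => 'd f y u) z v = 'd (fun y => 'd f y v) z u.
Proof.
move=> oA [Cf Cdf] Az; apply/rowP => j.
pose P (q : R * R) := z + q.1 *: u + q.2 *: v.
have Pc : P @ (0, 0) --> z.
  have -> : z = z + (0 : R) *: u + (0 : R) *: v by rewrite !scale0r !addr0.
  apply: cvgD; [apply: cvgD; [exact: cvg_cst|]|]; apply: cvgZ; try exact: cvg_cst.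
    exact: cvg_fst.
  exact: cvg_snd.
have PA : \forall q \near ((0, 0) : R * R), A (P q).
  exact: (Pc A (open_nbhs_nbhs (conj oA Az))).
pose D2 y := 'd (fun y => 'd f y u) y v 0 j.
have H := @mixed_derivative R setT (fun s r => f (P (s, r)) 0 j)
  (fun s r => 'd f (P (s, r)) u 0 j)
  (fun s r => D2 (P (s, r)))
  (fun s => 'd f (z + s *: u) v 0 j) 0.
have P00 : P (0, 0) = z by rewrite /P /= !scale0r !addr0.
have E1 := @deriv_within_coord _ _ _ _ _ _ _ 0 j (@diff_line0 _ _ (fun y => 'd f y v) z u (proj1 (Cdf v z Az))).
rewrite -[LHS]/(D2 z) -[z in LHS]P00; apply: (deriv_within_unique (setT_proper 0) _ E1); apply: H.
- apply: filterS PA => -[s r] /= Asr; split; apply: deriv_within_coord.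
    have [df _] := Cf _ Asr.
    have := @diff_line _ _ f (z + r *: v) u (P (s, r)) s.
    rewrite (_ : (fun s0 => _) = fun s0 => f (P (s0, r))); last first.
      by apply/funext => s0; rewrite /P /= addrAC.
    by apply; [rewrite /P /= addrAC|exact: df].
  have [df _] := Cdf u _ Asr.
  exact: (@diff_line _ _ (fun y => 'd f y u) (z + s *: u) v _ r).
- have : \forall s \near (0 : R), A (z + s *: u).
    exact: (@line_cvg _ z u _ (open_nbhs_nbhs (conj oA Az))).
  apply: filterS => s As; apply: deriv_within_coord.
  have [df _] := Cf _ As.
  exact: (@diff_line0 _ _ f _ v df).
- rewrite P00; have [_ cd] := Cdf u z Az.
  exact: (cvg_comp _ (fun M : 'rV_p => M 0 j) (cvg_comp _ _ Pc (cd v))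
    (@coord_continuous R 1 p 0 j _)).
Qed.

(** Besides ['d f z ('d h z e)], the product rule gives a sum over [j] of [h z 0 j] times the second
    derivative of [f] in the directions of the [j]-th basis vector and of [e]; by symmetry [e] can
    be the inner direction, and the sum becomes one differential in the direction [h z]. It serves
    to differentiate the transformation rule of a vector field. *)
Lemma C2_diff_along m p (A : set 'rV[R]_m) (f : 'rV[R]_m -> 'rV[R]_p)
    (h : 'rV[R]_m -> 'rV[R]_m) z e :
  open A -> C2_on A f -> A z -> differentiable h z ->
  deriv_within setT (fun s : R => 'd f (z + s *: e) (h (z + s *: e))) 0
    ('d f z ('d h z e) + 'd (fun y => 'd f y e) z (h z)).
Proof.
move=> oA Cf Az dh.
have E (D : {linear 'rV[R]_m -> 'rV[R]_p}) v :
    D v = \sum_j v 0 j *: D (delta_mx 0 j).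
  rewrite {1}[v]row_sum_delta linear_sum; apply: eq_bigr => j _.
  by rewrite linearZ.
rewrite (_ : (fun s => _) = fun s => \sum_j h (z + s *: e) 0 j *:
    'd f (z + s *: e) (delta_mx 0 j)); last by apply/funext => s; exact: E.
rewrite (_ : 'd f z ('d h z e) + 'd (fun y => 'd f y e) z (h z) =
  \sum_j ('d h z e 0 j *: 'd f (z + 0 *: e) (delta_mx 0 j) +
    h (z + 0 *: e) 0 j *: 'd (fun y => 'd f y (delta_mx 0 j)) z e)).
  apply: deriv_within_sum => j; have [_ Cdf] := Cf.
  apply: (@deriv_withinZ _ _ _ (fun s => h (z + s *: e) 0 j)
    (fun s => 'd f (z + s *: e) (delta_mx 0 j))).
    exact: (@deriv_within_coord _ _ _ _ _ _ _ 0 j (@diff_line0 _ _ h z e dh)).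
  exact: (@diff_line0 _ _ (fun y => 'd f y (delta_mx 0 j)) z e
    (proj1 (Cdf _ z Az))).
rewrite big_split /=; apply: congr2.
  apply: etrans (E ('d f z) _) _; apply: eq_bigr => j _.
  by rewrite scale0r addr0.
apply: etrans (E ('d (fun y => 'd f y e) z) _) _; apply: eq_bigr => j _.
rewrite scale0r addr0; apply: congr1.
exact: (C2_diff_sym e (delta_mx 0 j) oA Cf Az).
Qed.

End SecondDerivative.

Section DiffComp.
Context {R : realType}.

Lemma diff_comp_near (U V W : normedModType R) (f : U -> V) (g : V -> W)
    (h : U -> W) x y : (\forall z \near x, g (f z) = h z) -> f x = y ->
  differentiable f x -> differentiable g y ->
  differentiable h x /\ forall v, 'd h x v = 'd g y ('d f x v).
Proof.
move=> gfh <- df dg.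
have [dh dhE] := @near_eq_diff _ _ _ (g \o f) h x gfh (differentiable_comp df dg).
split; first exact: dh.
by move=> v; rewrite dhE (diff_comp df dg).
Qed.

End DiffComp.

(** * Charts, tangent spaces and the normal bundle *)

Section Charts.
Context {R : realType} {m : nat} {M : manifoldC2 R m}.
Implicit Types (x y : M) (c : chart R m M) (U : set M).
Local Notation tr c c' := (ccoord c' \o cparam c).

Lemma nbhs_cdom c y : cdom c y -> \forall z \near y, cdom c z.
Proof. by move=> cy; exact: open_nbhs_nbhs (conj (cdom_open c) cy). Qed.

Lemma nbhs_cimg c y : cdom c y ->
  \forall z \near ccoord c y, (ccoord c @` cdom c) z.
Proof.
move=> cy; apply: open_nbhs_nbhs; split; first exact: cimg_open.
by exists y.
Qed.

Lemma cparamK c z : (ccoord c @` cdom c) z ->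
  cdom c (cparam c z) /\ ccoord c (cparam c z) = z.
Proof. by move=> [y cy <-]; rewrite ccoordK. Qed.

Lemma cparam_cvg c y : cdom c y -> cparam c @ ccoord c y --> y.
Proof.
move=> cy; have := @cparam_cont _ _ _ c (ccoord c y).
by rewrite /prop_for /continuous_at ccoordK //; apply; exists y.
Qed.

Lemma open_cimg c U : open U -> open (ccoord c @` (cdom c `&` U)).
Proof.
move=> oU; rewrite openE => _ [y [cy Uy] <-].
have := cparam_cvg cy (open_nbhs_nbhs (conj oU Uy)).
apply: filterS2 (nbhs_cimg cy) => z /cparamK[cz zE] Uz.
by exists (cparam c z).
Qed.

Lemma cimgI c U y : cdom c y -> U y -> (ccoord c @` (cdom c `&` U)) (ccoord c y).
Proof. by exists y. Qed.

Lemma transition_diff c c' y : chart_at y c -> chart_at y c' ->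
  differentiable (tr c c') (ccoord c y).
Proof.
move=> [ac cy] [ac' c'y].
by have [] := proj1 (atlas_compat ac ac') _ (cimgI cy c'y).
Qed.

Lemma diff_chart_change (V : normedModType R) (f : V -> M) z0 c c' :
  {for z0, continuous f} -> chart_at (f z0) c -> chart_at (f z0) c' ->
  differentiable (ccoord c \o f) z0 ->
  differentiable (ccoord c' \o f) z0 /\
  forall v, 'd (ccoord c' \o f) z0 v =
    'd (tr c c') (ccoord c (f z0)) ('d (ccoord c \o f) z0 v).
Proof.
move=> cf cz cz' df; have dt := transition_diff cz cz'.
apply: (diff_comp_near _ erefl df dt).
have H := cf _ (nbhs_cdom (proj2 cz)).
by apply: (@filterS _ (nbhs z0) _ _ _ _ H) => z /= fz; rewrite ccoordK.
Qed.

Lemma diff_param_change (W : normedModType R) (f : M -> W) y c c' :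
  chart_at y c -> chart_at y c' ->
  differentiable (f \o cparam c') (ccoord c' y) ->
  differentiable (f \o cparam c) (ccoord c y) /\
  forall v, 'd (f \o cparam c) (ccoord c y) v =
    'd (f \o cparam c') (ccoord c' y) ('d (tr c c') (ccoord c y) v).
Proof.
move=> cy cy' df; have dt := transition_diff cy cy'.
have E : tr c c' (ccoord c y) = ccoord c' y by rewrite /= (ccoordK (proj2 cy)).
apply: (diff_comp_near _ E dt df).
have H := cparam_cvg (proj2 cy) (nbhs_cdom (proj2 cy')).
by apply: (@filterS _ (nbhs (ccoord c y)) _ _ _ _ H) => z /= cz; rewrite ccoordK.
Qed.

Lemma transition_id c y : chart_at y c -> forall v, 'd (tr c c) (ccoord c y) v = v.
Proof.
move=> [_ cy] v.
have [||_ ->] := @near_eq_diff _ _ _ (fun z => z) (tr c c) (ccoord c y).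
- by apply: filterS (nbhs_cimg cy) => z /cparamK[_ /= ->].
- exact: ex_diff.
- by rewrite diff_val.
Qed.

Lemma transition_trans c c' c'' y :
  chart_at y c -> chart_at y c' -> chart_at y c'' -> forall v,
  'd (tr c c'') (ccoord c y) v =
  'd (tr c' c'') (ccoord c' y) ('d (tr c c') (ccoord c y) v).
Proof.
move=> cy cy' cy'' v.
have [_ H] := diff_param_change cy cy' (transition_diff cy' cy'').
exact: H.
Qed.

Lemma tspace_eq c x (v w : tvec M) : tspace x v -> tspace x w -> chart_at x c ->
  v c = w c -> v = w.
Proof.
move=> [vT v0] [wT w0] cx vw; apply/funext => c'.
have [cx'|cx'] := pselect (chart_at x c').
  by rewrite (vT c c') // (wT c c') // vw.
by rewrite v0 // w0.
Qed.

Lemma tvecD (v w : tvec M) c : (v + w) c = v c + w c. Proof. by []. Qed.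

Lemma tvecN (v : tvec M) c : (- v) c = - v c. Proof. by []. Qed.

Lemma tvecZ (a : R) (v : tvec M) c : (a *: v) c = a *: v c. Proof. by []. Qed.

Lemma tvec_sum I (r : seq I) (F : I -> tvec M) c :
  (\sum_(i <- r) F i) c = \sum_(i <- r) F i c.
Proof. by elim/big_rec2: _ => // i u v _ <-. Qed.

Lemma tspace0 x : tspace x (0 : tvec M).
Proof. by split => // c c' _ _; rewrite linear0. Qed.

Lemma tspaceD x (v w : tvec M) : tspace x v -> tspace x w -> tspace x (v + w).
Proof.
move=> [vT v0] [wT w0]; split => [c c' cx cx'|c cx]; rewrite !tvecD.
  by rewrite (vT c c') // (wT c c') // linearD.
by rewrite v0 // w0 // addr0.
Qed.

Lemma tspaceZ x (a : R) (v : tvec M) : tspace x v -> tspace x (a *: v).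
Proof.
move=> [vT v0]; split => [c c' cx cx'|c cx]; rewrite !tvecZ.
  by rewrite (vT c c') // linearZ.
by rewrite v0 // scaler0.
Qed.

Lemma tspaceB x (v w : tvec M) : tspace x v -> tspace x w -> tspace x (v - w).
Proof. by move=> vT wT; rewrite -scaleN1r; apply: tspaceD => //; exact: tspaceZ. Qed.

Lemma tspace_sum x I (r : seq I) (F : I -> tvec M) :
  (forall i, tspace x (F i)) -> tspace x (\sum_(i <- r) F i).
Proof. by move=> FT; elim/big_ind: _ => //; [exact: tspace0|exact: tspaceD]. Qed.

Definition coord_field c (e : 'rV[R]_m) y : tvec M := fun c' =>
  if `[< chart_at y c' >] then 'd (tr c c') (ccoord c y) e else 0.

Lemma coord_fieldE c e y c' : chart_at y c' ->
  coord_field c e y c' = 'd (tr c c') (ccoord c y) e.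
Proof. by move=> cy; rewrite /coord_field asboolT. Qed.

Lemma coord_field_id c e y : chart_at y c -> coord_field c e y c = e.
Proof. by move=> cy; rewrite coord_fieldE // transition_id. Qed.

Lemma tspace_coord_field c e y : chart_at y c -> tspace y (coord_field c e y).
Proof.
move=> cy; split => [c' c'' cy' cy''|c' cy'].
  rewrite (coord_fieldE _ _ cy') (coord_fieldE _ _ cy'').
  exact: (transition_trans cy cy' cy'').
by rewrite /coord_field asboolF.
Qed.

(** In another chart the components are a first derivative of one transition composed with the
    inverse transition, so class C2 of the atlas makes them C1. *)
Lemma coord_field_C1 c e : atlas c -> vfield_C1 (cdom c) (coord_field c e).
Proof.
move=> ac; split; first exact: cdom_open.
  by move=> y cy; exact: tspace_coord_field.
move=> c' ac'.
have oA := @open_cimg c' (cdom c) (cdom_open c).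
have [Ct _] := atlas_compat ac' ac; have [_ Cdt] := atlas_compat ac ac'.
apply: (@C1_on_near_eq _ _ _ _ ((fun z => 'd (tr c c') z e) \o tr c' c)).
- exact: oA.
- move=> z /set_mem[y [cy' cy] <-] /=.
  by rewrite /local_expr !ccoordK // coord_fieldE.
- apply: (C1_on_comp oA _ Ct (Cdt e)) => z [y [cy' cy] <-] /=.
  by rewrite ccoordK //; exists y.
Qed.

Lemma coord_field_basis c x (v : tvec M) : tspace x v -> chart_at x c ->
  v = \sum_j v c 0 j *: coord_field c (delta_mx 0 j) x.
Proof.
move=> vT cx; apply: (@tspace_eq c x) => //.
  by apply: tspace_sum => j; apply: tspaceZ; exact: tspace_coord_field.
rewrite tvec_sum {1}[v c]row_sum_delta; apply: eq_bigr => j _.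
by rewrite tvecZ coord_field_id.
Qed.

End Charts.

(** * Limits of combinations of a varying frame *)

Section MatrixLimits.
Context {R : realType} {T : Type} {F : set_system T} {FF : ProperFilter F}.

Lemma cvg_mxP p q (A : T -> 'M[R]_(p, q)) (A0 : 'M[R]_(p, q)) :
  (forall i j, (A s i j) @[s --> F] --> A0 i j) -> A @ F --> A0.
Proof.
move=> AA; apply/cvgrPdist_le => e e0.
have H : \forall s \near F, forall ij : 'I_p * 'I_q,
    `|A0 ij.1 ij.2 - A s ij.1 ij.2| <= e.
  apply: (@filter_forall _ _ _ F) => ij.
  by move/cvgrPdist_le : (AA ij.1 ij.2) => /(_ e e0).
apply: filterS H => s H.
rewrite /Num.Def.normr /= mx_normrE; apply: bigmax_le => [|ij _]; first exact: ltW.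
by rewrite !mxE.
Qed.

Lemma cvg_coord p q (A : T -> 'M[R]_(p, q)) (A0 : 'M[R]_(p, q)) i j :
  A @ F --> A0 -> (A s i j) @[s --> F] --> A0 i j.
Proof.
move=> AA; exact: (cvg_comp _ (fun M : 'M[R]_(p, q) => M i j) AA
  (@coord_continuous R p q i j A0)).
Qed.

Lemma cvg_mulmx p q r (A : T -> 'M[R]_(p, q)) (B : T -> 'M[R]_(q, r))
    (A0 : 'M[R]_(p, q)) (B0 : 'M[R]_(q, r)) :
  A @ F --> A0 -> B @ F --> B0 -> (A s *m B s) @[s --> F] --> A0 *m B0.
Proof.
move=> AA BB; apply: cvg_mxP => i j; rewrite mxE.
rewrite [X in X @ _](_ : _ = fun s => \sum_k A s i k * B s k j); last first.
  by apply/funext => s; rewrite mxE.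
apply: (cvg_big add_continuous) => k _.
by apply: cvgM; exact: cvg_coord.
Qed.

(* With B a right inverse of E0, the coefficients satisfy
   q = (q E) B + q (E0 - E) B, so that they remain bounded. *)
Lemma frame_limit k m (E : T -> 'M[R]_(k, m)) (E0 : 'M[R]_(k, m))
    (q : T -> 'rV[R]_k) (l : 'rV[R]_m) :
  row_free E0 -> E @ F --> E0 -> (q s *m E s) @[s --> F] --> l ->
  exists a, l = a *m E0.
Proof.
move=> /row_freeP[B E0B] EE qE.
pose D s := (E0 - E s) *m B.
have DF i j : (D s i j) @[s --> F] --> (0 : R).
  have : D @ F --> (0 : 'M[R]_k).
    rewrite -(mul0mx _ B) -(subrr E0).
    apply: cvg_mulmx; last exact: cvg_cst.
    by apply: cvgB => //; exact: cvg_cst.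
  by move=> /(@cvg_coord _ _ _ _ i j); rewrite mxE.
have qB : (q s *m E s *m B) @[s --> F] --> l *m B.
  by apply: cvg_mulmx => //; exact: cvg_cst.
have qDE s : q s = q s *m E s *m B + q s *m D s.
  by rewrite /D mulmxBl E0B mulmxBr mulmx1 mulmxA addrC subrK.
have Dsmall e : 0 < e -> \forall s \near F, forall v : 'rV[R]_k,
    `|v *m D s| <= e * `|v|.
  (* A sum of [k] terms bounded by [d] times the norm of [v] stays below [e] times that norm; [k.+1]
     keeps the divisor nonzero when [k = 0]. *)
  move=> e0; pose d := e / k.+1%:R.
  have d0 : 0 < d by rewrite divr_gt0.
  have H : \forall s \near F, forall ij : 'I_k * 'I_k, `|D s ij.1 ij.2| <= d.
    apply: (@filter_forall _ _ _ F) => ij.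
    move/cvgrPdist_le : (DF ij.1 ij.2) => /(_ d d0).
    by apply: filterS => s; rewrite sub0r normrN.
  apply: filterS H => s H v.
  apply: row_norm_le => [|j]; first by rewrite mulr_ge0 // ltW.
  rewrite mxE; apply: le_trans (ler_norm_sum _ _ _) _.
  apply: (@le_trans _ _ (\sum_(i < k) `|v| * d)).
    apply: ler_sum => i _; rewrite normrM; apply: ler_pM => //.
      exact: coord_norm_le.
    exact: (H (i, j)).
  rewrite sumr_const card_ord -[leLHS]mulr_natr -mulrA [leRHS]mulrC ler_wpM2l //.
  rewrite /d -mulrA ger_pMr // mulrC ler_pdivrMr // mul1r ler_nat.
  exact: leqnSn.
(* With the factor [1 / 2], the term [q s *m D s] is absorbed by the left-hand side. *)
have qbound : \forall s \near F, `|q s| <= 2 * (`|l *m B| + 1).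
  have H1 := Dsmall (1 / 2) (divr_gt0 ltr01 (ltr0Sn R 1)).
  have H2 : \forall s \near F, `|q s *m E s *m B| <= `|l *m B| + 1.
    move/cvgrPdist_le : qB => /(_ 1 ltr01); apply: filterS => s.
    move=> H; rewrite addrC -lerBlDr; apply: le_trans H.
    by rewrite distrC; exact: lerB_dist.
  apply: filterS2 H1 H2 => s H1 H2.
  have : `|q s| <= (`|l *m B| + 1) + 1 / 2 * `|q s|.
    rewrite {1}[q s]qDE; apply: le_trans (ler_normD _ _) _.
    by apply: lerD => //; exact: H1.
  rewrite -lerBlDr -{1}(mul1r `|q s|) -mulrBl.
  have -> : 1 - 1 / 2 = (2 : R)^-1 by rewrite {1}(splitr 1) !div1r addrK.
  by rewrite ler_pdivrMl.
have qD : (q s *m D s) @[s --> F] --> (0 : 'rV[R]_k).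
  apply/cvgrPdist_le => e e0.
  pose c := 2 * (`|l *m B| + 1).
  have c0 : 0 < c by rewrite mulr_gt0 // ltr_wpDl.
  have H1 := Dsmall (e / c) (divr_gt0 e0 c0).
  apply: filterS2 H1 qbound => s /(_ (q s)) H1 H2.
  rewrite sub0r normrN (le_trans H1) //.
  by rewrite -[leRHS](divfK (lt0r_neq0 c0) e) ler_wpM2l // divr_ge0 // ltW.
(* Since [q] is bounded and [D] tends to 0, [q] itself converges, and [l] is identified by
   uniqueness of the limit of [q s *m E s]. *)
have qc : q @ F --> l *m B.
  rewrite -[X in _ --> X]addr0 [X in X @ _](_ : _ = fun s =>
    q s *m E s *m B + q s *m D s); first exact: cvgD.
  by apply/funext.
exists (l *m B).
apply: (cvg_unique _ qE (cvg_mulmx qc EE)); exact: norm_hausdorff.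
Qed.

End MatrixLimits.

(** * Normal components and slice charts *)

Section NormalPart.
Context {R : realType} {m : nat} (n : nat).

(** In a slice chart, these are the coordinates of the class of [v] modulo [TN]. The zeros in the
    first [n] places keep the result in ['rV[R]_m], so that differentials of vector fields can be
    applied to it. *)
Definition npart (v : 'rV[R]_m) : 'rV[R]_m :=
  \row_j (if (n <= j)%N then v 0 j else 0).

Lemma npartE v (j : 'I_m) : (n <= j)%N -> npart v 0 j = v 0 j.
Proof. by move=> nj; rewrite mxE nj. Qed.

Lemma npart0P v :
  npart v = 0 <-> forall j : 'I_m, (n <= j)%N -> v 0 j = 0.
Proof.
split=> [v0 j nj|v0]; first by rewrite -npartE // v0 mxE.
by apply/rowP => j; rewrite !mxE; case: ifP => // /v0.
Qed.

Lemma npartD v w : npart (v + w) = npart v + npart w.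
Proof. by apply/rowP => j; rewrite !mxE; case: ifP => // _; rewrite addr0. Qed.

Lemma npartZ (a : R) v : npart (a *: v) = a *: npart v.
Proof. by apply/rowP => j; rewrite !mxE; case: ifP => // _; rewrite mulr0. Qed.

Lemma npartB v w : npart (v - w) = npart v - npart w.
Proof. by rewrite -scaleN1r npartD npartZ scaleN1r. Qed.

Lemma npart0 : npart 0 = 0.
Proof. by apply/npart0P => j _; rewrite mxE. Qed.

Lemma npart_sum I (r : seq I) F :
  npart (\sum_(i <- r) F i) = \sum_(i <- r) npart (F i).
Proof. by apply: (big_morph npart) => [v w|]; [exact: npartD|exact: npart0]. Qed.

Lemma npartK v : npart (npart v) = npart v.
Proof. by apply/rowP => j; rewrite !mxE; case: leqP. Qed.

Lemma npart_norm v : `|npart v| <= `|v|.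
Proof.
apply: row_norm_le => // j; rewrite mxE; case: ifP => _; first exact: coord_norm_le.
by rewrite normr0.
Qed.

Lemma deriv_within_npart I (g : R -> 'rV[R]_m) t v :
  deriv_within I g t v -> deriv_within I (npart \o g) t (npart v).
Proof.
move=> gv; apply: deriv_within_row => j; rewrite !mxE; case: ifP => nj.
  rewrite (_ : (fun s => _) = fun s => g s 0 j); first exact: deriv_within_coord.
  by apply/funext => s; rewrite /= npartE.
rewrite (_ : (fun s => _) = fun=> 0); first exact: deriv_within_cst.
by apply/funext => s; rewrite /= mxE nj.
Qed.

End NormalPart.

Section Slices.
Context {R : realType} {m : nat} {M : manifoldC2 R m}.
Variables (N : set M) (n : nat).
Implicit Types (x y : M) (c : chart R m M) (W : set M).
Local Notation tr c c' := (ccoord c' \o cparam c).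
Local Notation tsub := (tspace_sub N n).
Local Notation npart := (npart n).

Lemma slice_near c x (e : 'rV[R]_m) : slice_chart N n c -> N x -> cdom c x ->
  npart e = 0 -> \forall s \near (0 : R), N (cparam c (ccoord c x + s *: e)).
Proof.
move=> [_ sc] Nx cx e0.
have H := @line_cvg _ _ (ccoord c x) e _ (nbhs_cimg cx).
apply: (@filterS _ (nbhs (0 : R)) _ _ _ _ H) => s /= /cparamK[cs sE].
apply/(sc _ cs) => j nj; rewrite sE !mxE.
have -> : ccoord c x ord0 j = 0 by move/(sc _ cx) : Nx; apply.
by have -> : e 0 j = 0; [by move/npart0P : e0; apply|rewrite mulr0 addr0].
Qed.

(** A line in a direction tangent to the slice stays in [N] for small times, so only the values on
    [N] enter the derivative. *)
Lemma slice_diff_eq c x (e : 'rV[R]_m) (f g : 'rV[R]_m -> 'rV[R]_m) :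
  slice_chart N n c -> N x -> cdom c x -> npart e = 0 ->
  differentiable f (ccoord c x) -> differentiable g (ccoord c x) ->
  (\forall z \near ccoord c x, N (cparam c z) -> npart (f z) = npart (g z)) ->
  npart ('d f (ccoord c x) e) = npart ('d g (ccoord c x) e).
Proof.
move=> sc Nx cx e0 df dg fg.
have Df := @deriv_within_npart _ _ n _ _ _ _ (@diff_line0 _ _ _ f _ e df).
have Dg := @deriv_within_npart _ _ n _ _ _ _ (@diff_line0 _ _ _ g _ e dg).
apply: (deriv_within_unique (setT_proper 0) _ Dg).
apply: (near_eq_deriv_within _ _ Df) => //.
have H1 := @line_cvg _ _ (ccoord c x) e _ fg.
apply: (@filterS2 _ (nbhs (0 : R)) _ _ _ _ _ H1 (slice_near sc Nx cx e0)) => s /=.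
by move=> H Ns _; exact: H.
Qed.

Lemma slice_diff0 c x (e : 'rV[R]_m) (f : 'rV[R]_m -> 'rV[R]_m) :
  slice_chart N n c -> N x -> cdom c x -> npart e = 0 ->
  differentiable f (ccoord c x) ->
  (\forall z \near ccoord c x, N (cparam c z) -> npart (f z) = 0) ->
  npart ('d f (ccoord c x) e) = 0.
Proof.
move=> sc Nx cx e0 df f0.
rewrite (slice_diff_eq (g := cst 0) sc Nx cx e0 df).
- by rewrite diff_cst npart0.
- exact: differentiable_cst.
- by apply: filterS f0 => z fz Nz; rewrite fz // npart0.
Qed.

(** One slice chart decides tangency: the normal components of a transition to another slice chart
    vanish on [N], hence so do those of its differential in directions tangent to the slice. *)
Lemma tspace_subP c x v : tspace x v -> slice_chart N n c -> N x -> cdom c x ->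
  tsub x v <-> npart (v c) = 0.
Proof.
move=> vT sc Nx cx; split=> [[_ v0]|v0]; first exact/npart0P/v0.
split; first exact: vT.
move=> c' sc' cx'; apply/npart0P.
have [cxA cxA'] : chart_at x c /\ chart_at x c'.
  by split; split => //; [case: sc|case: sc'].
have -> : v c' = 'd (tr c c') (ccoord c x) (v c) by case: vT => + _; apply.
apply: (slice_diff0 sc Nx cx v0); first exact: transition_diff.
have H := cparam_cvg cx (nbhs_cdom cx').
apply: (@filterS _ (nbhs (ccoord c x)) _ _ _ _ H) => z /= cz Nz.
by apply/npart0P => j nj; move: nj; apply: (proj1 (proj2 sc' _ cz)).
Qed.

Lemma tsub_npart c x v : slice_chart N n c -> cdom c x -> tsub x v ->
  npart (v c) = 0.
Proof. by move=> sc cx [_ v0]; apply/npart0P/v0. Qed.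

Lemma tsub0 x : tsub x 0.
Proof. by split=> [|c _ _ j _]; [exact: tspace0|rewrite mxE]. Qed.

Lemma tsubN x v : tsub x v -> tsub x (- v).
Proof.
move=> [vT v0]; split; first by rewrite -scaleN1r; exact: tspaceZ.
by move=> c sc cx j nj; rewrite tvecN mxE v0 // oppr0.
Qed.

Lemma tsubD x v w : tsub x v -> tsub x w -> tsub x (v + w).
Proof.
move=> [vT v0] [wT w0]; split; first exact: tspaceD.
by move=> c sc cx j nj; rewrite tvecD mxE v0 // w0 // addr0.
Qed.

Lemma ncls_refl x v : tspace x v -> ncls N n x v v.
Proof. by move=> vT; split=> //; rewrite subrr; exact: tsub0. Qed.

Lemma ncls_eq x v w : tspace x v -> tspace x w ->
  ncls N n x v = ncls N n x w <-> tsub x (v - w).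
Proof.
move=> vT wT; split=> [E|vw].
  by have := ncls_refl vT; rewrite E => -[].
apply/seteqP; split => u [uT uv]; split => //.
  by rewrite -(subrKA v); exact: tsubD.
by rewrite -(subrKA w); apply: tsubD => //; rewrite -opprB; exact: tsubN.
Qed.

(** An arbitrary member of the coset, 0 if there is none; only its normal components in slice charts
    are used, and these do not depend on the member. *)
Definition nrep (z : set (tvec M)) : tvec M := xget 0 z.

Lemma nrep_npart c x v : slice_chart N n c -> cdom c x -> tspace x v ->
  npart (nrep (ncls N n x v) c) = npart (v c).
Proof.
move=> sc cx vT; have := xgetI 0 (ncls_refl vT) => -[_].
by move/(tsub_npart sc cx); rewrite tvecD tvecN npartB => /subr0_eq.
Qed.

End Slices.

(** * Sections of K and the partial connection *)

Section Fields.
Context {R : realType} {m : nat} {M : manifoldC2 R m}.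
Implicit Types (x y : M) (c : chart R m M) (W : set M).

Lemma vfield_diff W (X : M -> tvec M) c x : vfield_C1 W X -> chart_at x c -> W x ->
  differentiable (local_expr X c) (ccoord c x).
Proof. by move=> [_ _ CX] [ac cx] Wx; have [] := CX c ac _ (cimgI cx Wx). Qed.

Lemma vfield_tspace W (X : M -> tvec M) x : vfield_C1 W X -> W x -> tspace x (X x).
Proof. by move=> [_ XT _] Wx; exact: XT. Qed.

Lemma vfield_C1_sub W W' (X : M -> tvec M) : open W' -> W' `<=` W ->
  vfield_C1 W X -> vfield_C1 W' X.
Proof.
move=> oW' sW [_ XT CX]; split=> [//|y /sW/XT//|c ac _ [y [cy Wy] <-]].
by apply: CX => //; exists y => //; split => //; exact: sW.
Qed.

Lemma lie_bracketE (X Y : M -> tvec M) c x : chart_at x c ->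
  lie_bracket X Y x c = 'd (local_expr Y c) (ccoord c x) (X x c) -
    'd (local_expr X c) (ccoord c x) (Y x c).
Proof. by move=> cx; rewrite /lie_bracket asboolT. Qed.

Lemma vfield_near W (X : M -> tvec M) c x : vfield_C1 W X -> cdom c x -> W x ->
  \forall z \near ccoord c x, W (cparam c z).
Proof.
by move=> [oW _ _] cx Wx; exact: (cparam_cvg cx (open_nbhs_nbhs (conj oW Wx))).
Qed.

Lemma local_exprE (X : M -> tvec M) c x : cdom c x ->
  local_expr X c (ccoord c x) = X x c.
Proof. by move=> cx; rewrite /local_expr ccoordK. Qed.

End Fields.

Section KSections.
Context {R : realType} {m : nat} {M : manifoldC2 R m}.
Variables (N : set M) (n k : nat) (K : M -> set (tvec M)).
Hypothesis hK : subbundle_C1 k K.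
Hypothesis hKN : forall x, N x -> K x `<=` tspace_sub N n x.
Implicit Types (x y : M) (c : chart R m M) (W : set M) (X Y : M -> tvec M).
Local Notation npart := (npart n).

(* When k = 0, the neighbourhood given by subbundle_C1 need not be open. *)
Lemma open_frame x : exists (U : set M) (E : 'I_k -> M -> tvec M),
  [/\ U x, open U, forall i, vfield_C1 U (E i) & forall y, U y ->
     K y = [set v | exists a : 'I_k -> R, v = \sum_i a i *: E i y] /\
     (forall a : 'I_k -> R, \sum_i a i *: E i y = 0 -> forall i, a i = 0)].
Proof.
case: k hK => [|k'] hK'; last first.
  have [U [E [Ux CE KE]]] := hK' x; exists U, E; split => //.
  by have [] := CE ord0.
exists setT, (fun=> fun=> 0); split; [exact: I|exact: openT|by case|move=> y _].
split; last by move=> a _ [].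
have [U [E [Uy _ /(_ _ Uy)[-> _]]]] := hK' y.
by apply/seteqP; split => v [a ->]; exists a; rewrite !big_ord0.
Qed.

Lemma Ksection_npart W X c x : slice_chart N n c -> cdom c x -> N x -> W x ->
  tangent_section K W X -> npart (X x c) = 0.
Proof. by move=> sc cx Nx Wx KX; apply: (tsub_npart sc cx); exact/hKN/KX. Qed.

Lemma Ksection_diff_tangent W X c x (e : 'rV[R]_m) :
  slice_chart N n c -> cdom c x -> N x -> W x -> vfield_C1 W X ->
  tangent_section K W X -> npart e = 0 ->
  npart ('d (local_expr X c) (ccoord c x) e) = 0.
Proof.
move=> sc cx Nx Wx CX KX e0; apply: (slice_diff0 sc Nx cx e0).
  by apply: (vfield_diff CX) => //; split => //; case: sc.
apply: filterS2 (nbhs_cimg cx) (vfield_near CX cx Wx) => z /cparamK[cz _] Wz Nz.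
exact: (Ksection_npart sc cz Nz Wz KX).
Qed.

Lemma Ksection_diff_npart W X c x (v w : 'rV[R]_m) :
  slice_chart N n c -> cdom c x -> N x -> W x -> vfield_C1 W X ->
  tangent_section K W X -> npart v = npart w ->
  npart ('d (local_expr X c) (ccoord c x) v) =
  npart ('d (local_expr X c) (ccoord c x) w).
Proof.
move=> sc cx Nx Wx CX KX vw; apply/subr0_eq; rewrite -npartB -linearB.
by apply: (Ksection_diff_tangent sc cx Nx Wx CX KX); rewrite npartB vw subrr.
Qed.

(** The direction [e] may be transverse to [N], so tangency along [N] says nothing directly about
    these derivatives. But [X - X'] vanishes at [x] and takes values in [K], so its difference
    quotients along the line are combinations of the frame at nearby points; by [frame_limit] their
    limit is a combination of the frame at [x], hence tangent to [N]. *)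
Lemma Ksection_diff_eq W X W' X' c x (e : 'rV[R]_m) :
  slice_chart N n c -> cdom c x -> N x -> W x -> W' x ->
  vfield_C1 W X -> vfield_C1 W' X' ->
  tangent_section K W X -> tangent_section K W' X' -> X x = X' x ->
  npart ('d (local_expr X c) (ccoord c x) e) =
  npart ('d (local_expr X' c) (ccoord c x) e).
Proof.
move=> sc cx Nx Wx Wx' CX CX' KX KX' XX'.
have cA : chart_at x c by split => //; case: sc.
have [U [E [Ux oU CE KE]]] := open_frame x.
pose y s := cparam c (ccoord c x + s *: e).
pose Z s := X (y s) c - X' (y s) c.
pose Em s : 'M[R]_(k, m) := \matrix_(i, j) E i (y s) c 0 j.
have y0 : y 0 = x by rewrite /y scale0r addr0 ccoordK.
have ZE s : W (y s) -> W' (y s) -> U (y s) -> exists q, Z s = q *m Em s.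
  move=> Wy Wy' Uy; have [KyE _] := KE _ Uy.
  have := KX _ Wy; have := KX' _ Wy'; rewrite KyE => -[b Xb] [a Xa].
  exists (\row_i (a i - b i)); rewrite /Z Xa Xb !tvec_sum -sumrB.
  apply/rowP => j; rewrite summxE mxE; apply: eq_bigr => i _.
  by rewrite !mxE mulrBl.
have [q qP] : {q : R -> 'rV[R]_k &
    forall s, W (y s) -> W' (y s) -> U (y s) -> Z s = q s *m Em s}.
  apply: (@choice _ _ (fun s q => W (y s) -> W' (y s) -> U (y s) -> Z s = q *m Em s)).
  move=> s; have [[Wy [Wy' Uy]]|nW] := pselect (W (y s) /\ W' (y s) /\ U (y s)).
    by have [q qE] := ZE s Wy Wy' Uy; exists q.
  by exists 0 => Wy Wy' Uy; case: nW.
have dZ : deriv_within setT Z 0 ('d (local_expr X c) (ccoord c x) e -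
    'd (local_expr X' c) (ccoord c x) e).
  by apply: deriv_withinB; apply: diff_line0; [exact: vfield_diff CX _ _|
    exact: vfield_diff CX' _ _].
rewrite -[LHS]subr0 -[RHS]add0r; apply/eqP; rewrite subr0 add0r -subr_eq0 -npartB.
set l := _ - _ in dZ *.
have PF := setT_proper (0 : R).
have lineF (P : set 'rV[R]_m) : (\forall z \near ccoord c x, P z) ->
    \forall s \near within setT (0 : R)^', P (ccoord c x + s *: e).
  move=> Pz; have H := @line_cvg _ _ (ccoord c x) e P Pz.
  by apply: (@filterS _ (nbhs (0 : R)) _ _ _ _ H) => s Ps _ _.
(* The difference quotients have coefficients [s^-1 *: q s], where [q] is a mere choice without
   known regularity. *)
have [|||a lE] := @frame_limit R _ _ PF k m Em (Em 0) (fun s => s^-1 *: q s) l.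
- apply: inj_row_free => a aE; apply/rowP => i; rewrite mxE.
  have [_ KI] := KE _ Ux; apply: (KI (fun i => a 0 i)).
  apply: (@tspace_eq _ _ _ c x) cA _; last 1 first.
  + rewrite tvec_sum -[RHS]aE; apply/rowP => j; rewrite summxE mxE.
    by apply: eq_bigr => i' _; rewrite !mxE y0.
  + by apply: tspace_sum => i'; apply: tspaceZ; exact: vfield_tspace (CE i') Ux.
  + exact: tspace0.
- apply: cvg_mxP => i j; rewrite mxE y0 -(local_exprE _ cx).
  rewrite (_ : (fun s => _) = fun s => local_expr (E i) c (ccoord c x + s *: e) 0 j);
    last by apply/funext => s; rewrite mxE.
  apply: cvg_coord => A /(differentiable_continuous (vfield_diff (CE i) cA Ux)).
  exact: lineF.
- apply: cvg_trans dZ; apply: near_eq_cvg.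
  have nU : \forall z \near ccoord c x,
      W (cparam c z) /\ W' (cparam c z) /\ U (cparam c z).
    apply: filterI; first exact: vfield_near CX cx Wx.
    apply: filterI; first exact: vfield_near CX' cx Wx'.
    exact: (cparam_cvg cx (open_nbhs_nbhs (conj oU Ux))).
  have H := lineF _ nU.
  apply: filterS H => s [Ws [Ws' Us]] /=.
  have Z0 : Z 0 = 0 by rewrite /Z y0 XX' subrr.
  by rewrite Z0 !subr0 (qP s Ws Ws' Us) scalemxAl.
apply/eqP; rewrite lE.
have -> : a *m Em 0 = \sum_i a 0 i *: E i x c.
  apply/rowP => j; rewrite summxE mxE; apply: eq_bigr => i _.
  by rewrite !mxE y0.
rewrite npart_sum big1 // => i _; rewrite npartZ (tsub_npart sc cx) ?scaler0 //.
apply: hKN => //; have [-> _] := KE _ Ux.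
exists (fun i' => (i' == i)%:R); rewrite (bigD1 i) //= eqxx scale1r big1 ?addr0 //.
by move=> i' /negPf ->; rewrite scale0r.
Qed.

(** Independence of the choices: the extensions [Xt] and [Yt] behind [w] can be exchanged for any
    section [X] of [K] with the same value at [x] and any field [Y] with the same classes along
    [N]. *)
Lemma nabla_npart W X W' Y c x w :
  slice_chart N n c -> cdom c x -> N x -> W x -> W' x ->
  vfield_C1 W X -> tangent_section K W X -> vfield_C1 W' Y ->
  nabla N n K x (X x) (fun y => ncls N n y (Y y)) w ->
  npart (w c) = npart ('d (local_expr Y c) (ccoord c x) (X x c)) -
    npart ('d (local_expr X c) (ccoord c x) (Y x c)).
Proof.
move=> sc cx Nx Wx Wx' CX KX CY [U [Xt [Yt [Ux [CXt CYt] [KXt XtE] repY [_ wL]]]]].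
have cA : chart_at x c by split => //; case: sc.
have repY' y : U y -> N y -> W' y -> cdom c y -> npart (Yt y c) = npart (Y y c).
  move=> Uy Ny Wy cy; have := repY y Uy Ny.
  have YT := vfield_tspace CY Wy; have YtT := vfield_tspace CYt Uy.
  by move/(ncls_eq N n YT YtT)/(tsub_npart sc cy); rewrite npartB => /subr0_eq.
have Vt : npart (X x c) = 0 by exact: Ksection_npart sc cx Nx Wx KX.
have -> : npart (w c) = npart (lie_bracket Xt Yt x c).
  by apply/subr0_eq; rewrite -npartB; exact: (tsub_npart sc cx wL).
have dYt := vfield_diff CYt cA Ux; have dY := vfield_diff CY cA Wx'.
(* [Yt] is exchanged for [Y] because they differ at [x] by a vector tangent to [N], then [Xt] for
   [X] because they agree at [x]. *)
have dXY : npart ('d (local_expr Xt c) (ccoord c x) (Yt x c)) =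
    npart ('d (local_expr X c) (ccoord c x) (Y x c)).
  apply: etrans (Ksection_diff_npart sc cx Nx Ux CXt KXt (repY' x Ux Nx Wx' cx)) _.
  exact: (Ksection_diff_eq _ sc cx Nx Ux Wx CXt CX KXt KX XtE).
(* The direction [X x] is tangent to [N], and on [N] the fields [Yt] and [Y] have the same normal
   components. *)
have dYX : npart ('d (local_expr Yt c) (ccoord c x) (X x c)) =
    npart ('d (local_expr Y c) (ccoord c x) (X x c)).
  apply: (slice_diff_eq sc Nx cx Vt dYt dY).
  have H : \forall z \near ccoord c x, U (cparam c z) /\ W' (cparam c z).
    by apply: filterI; [exact: vfield_near CYt cx Ux|exact: vfield_near CY cx Wx'].
  apply: filterS2 (nbhs_cimg cx) H => z /cparamK[cz _] [Uz Wz] Nz.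
  exact: (repY' _ Uz Nz Wz cz).
rewrite (lie_bracketE _ _ cA) npartB; apply: (congr2 (fun u v => u - v)) dXY.
apply: etrans dYX.
exact: (congr1 (fun v : tvec M => npart ('d (local_expr Yt c) (ccoord c x) (v c))) XtE).
Qed.

(** The terms [a i *: D (y i)] subtracted by the connection are restored by [D] applied to the whole
    section; the product rule for the components remains. *)
Lemma npart_leibniz (D : {linear 'rV[R]_m -> 'rV[R]_m}) p (a a' : 'I_p -> R)
    (y b w : 'I_p -> 'rV[R]_m) :
  (forall i, npart (w i) = npart (b i) - npart (D (y i))) ->
  npart (\sum_i (a' i *: y i + a i *: w i)) + npart (D (\sum_i a i *: y i)) =
  npart (\sum_i (a' i *: y i + a i *: b i)).
Proof.
move=> wE; rewrite linear_sum -npartD -big_split /= !npart_sum.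
apply: eq_bigr => i _.
by rewrite linearZ /= !npartD !npartZ wE scalerBr -!addrA addNr addr0.
Qed.

(** The product rule for a local representation of [eta], with [nabla_npart] for each term. It turns
    the covariant derivative into a linear differential equation for the normal components, with [u]
    as inhomogeneous term. *)
Lemma nabla_along_deriv W X (I : set R) (g : R -> M) (eta : R -> set (tvec M)) t c u :
  I t -> ProperFilter (within I t^') -> slice_chart N n c -> cdom c (g t) ->
  N (g t) -> W (g t) -> vfield_C1 W X -> tangent_section K W X ->
  velocity I g t (X (g t)) -> nabla_along N n K I g eta t u ->
  deriv_within I (fun s => npart (nrep (eta s) c)) t
    (npart (u c) + npart ('d (local_expr X c) (ccoord c (g t))
       (npart (nrep (eta t) c)))).
Proof.
move=> It PF sc cx Nx Wx CX KX [gc XT gX] [V [p [U [Y [a [a' [w]]]]]]].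
move=> [[[_ VT gV] Ux] [CY da] etaE wN [uT uE]].
have cA : chart_at (g t) c by split => //; case: sc.
have VE : V = X (g t).
  apply: (tspace_eq VT XT cA).
  exact: deriv_within_unique (gV c cA) (gX c cA).
have dg := gX c cA.
have near_c : \forall s \near within I (nbhs t), 
    cdom c (g s) /\ forall i, tspace (g s) (Y i (g s)).
  apply: filterI; first exact: gc (nbhs_cdom cx).
  apply: (@filter_forall _ _ _ (within I (nbhs t))) => i; have [oU YT _] := CY i.
  have H : nbhs (g t) (fun y => tspace y (Y i y)).
    exact: (@filterS _ _ _ _ _ YT (open_nbhs_nbhs (conj oU Ux))).
  exact: (gc _ H).
have etaP s : cdom c (g s) -> (forall i, tspace (g s) (Y i (g s))) ->
    eta s = ncls N n (g s) (\sum_i a i s *: Y i (g s)) ->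
   npart (nrep (eta s) c) = npart (\sum_i a i s *: local_expr (Y i) c (ccoord c (g s))).
  move=> cs Us ->; rewrite nrep_npart //; last first.
    by apply: tspace_sum => i; apply: tspaceZ; exact: Us.
  by rewrite tvec_sum; under [in RHS]eq_bigr => i _ do rewrite local_exprE //.
have dsum : deriv_within I
    (fun s => \sum_i a i s *: local_expr (Y i) c (ccoord c (g s))) t
    (\sum_i (a' i *: Y i (g t) c +
       a i t *: 'd (local_expr (Y i) c) (ccoord c (g t)) (X (g t) c))).
  apply: deriv_within_sum => i; rewrite -(local_exprE _ cx).
  apply: deriv_withinZ => //.
  exact: (deriv_within_comp dg (vfield_diff (CY i) cA Ux)).
have etat : npart (nrep (eta t) c) = npart (\sum_i a i t *: Y i (g t) c).
  have := nbhs_singleton etaE It; move/(etaP t cx (fun i => vfield_tspace (CY i) Ux)) => ->.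
  by under eq_bigr => i _ do rewrite local_exprE //.
have -> : npart (u c) + npart ('d (local_expr X c) (ccoord c (g t))
       (npart (nrep (eta t) c))) = npart (\sum_i (a' i *: Y i (g t) c +
       a i t *: 'd (local_expr (Y i) c) (ccoord c (g t)) (X (g t) c))).
  rewrite (Ksection_diff_npart (v := npart (nrep (eta t) c))
    (w := \sum_i a i t *: Y i (g t) c) sc cx Nx Wx CX KX); last first.
    by rewrite npartK etat.
  have -> : npart (u c) = npart ((\sum_i (a' i *: Y i (g t) + a i t *: w i)) c).
    by apply/subr0_eq; rewrite -npartB; exact: (tsub_npart sc cx uE).
  rewrite tvec_sum.
  apply: (@npart_leibniz ('d (local_expr X c) (ccoord c (g t))) p
    (fun i => a i t) a' (fun i => Y i (g t) c) _ (fun i => w i c)) => i.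
  have wN' : nabla N n K (g t) (X (g t)) (fun y => ncls N n y (Y i y)) (w i).
    by rewrite -VE; exact: wN.
  exact: (nabla_npart sc cx Nx Wx Ux CX KX (CY i) wN').
apply: (near_eq_deriv_within It _ (@deriv_within_npart _ _ n _ _ _ _ dsum)).
apply: filterS2 etaE near_c => s etas [cs Us].
by rewrite (etaP s cs Us etas).
Qed.

End KSections.

(** * Brackets with coordinate fields *)

Section Bracket.
Context {R : realType} {m : nat} {M : manifoldC2 R m}.
Implicit Types (x : M) (c : chart R m M) (W : set M).
Local Notation tr c c' := (ccoord c' \o cparam c).

Lemma tspace_transition (X : M -> tvec M) c c' x :
  chart_at x c -> chart_at x c' -> tspace x (X x) ->
  'd (tr c c') (ccoord c x) (local_expr X c (ccoord c x)) =
  local_expr X c' (tr c c' (ccoord c x)).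
Proof.
move=> cx cx' [XT _]; rewrite (local_exprE X (proj2 cx)) /=.
rewrite (ccoordK (proj2 cx)) (local_exprE X (proj2 cx')).
by apply/esym; exact: XT.
Qed.

(** [lie_bracket] is computed chart by chart, so its being a tangent vector needs proof. In [c] the
    coordinate field is constant and only the derivative of [X] along [e] survives; in [c'] both
    terms of the bracket contain the second derivative of the transition in the directions [e] and
    [X x c], and these two occurrences cancel. *)
Lemma lie_bracket_coord_field W X c x (e : 'rV[R]_m) : vfield_C1 W X -> W x ->
  chart_at x c -> lie_bracket X (coord_field c e) x =
    coord_field c (- 'd (local_expr X c) (ccoord c x) e) x.
Proof.
move=> CX Wx cx; apply/funext => c'.
have [cx'|cx'] := pselect (chart_at x c'); last first.
  by rewrite /lie_bracket /coord_field !asboolF.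
have XT := vfield_tspace CX Wx.
rewrite (lie_bracketE _ _ cx') (coord_fieldE _ _ cx') (coord_fieldE _ _ cx').
have C2t : C2_on (ccoord c @` (cdom c `&` cdom c')) (tr c c').
  by apply: atlas_compat; [case: cx|case: cx'].
have oA := @open_cimg _ _ _ c (cdom c') (cdom_open c').
have Az : (ccoord c @` (cdom c `&` cdom c')) (ccoord c x).
  by apply: cimgI; [case: cx|case: cx'].
have tE : tr c c' (ccoord c x) = ccoord c' x.
  by rewrite /= (ccoordK (proj2 cx)).
have dt := transition_diff cx cx'.
have YE : 'd (local_expr (coord_field c e) c') (ccoord c' x) (X x c') =
    'd (fun y => 'd (tr c c') y e) (ccoord c x) (X x c).
  have -> : X x c' = 'd (tr c c') (ccoord c x) (X x c) by case: XT => + _; apply.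
  have CY := coord_field_C1 e (proj1 cx).
  have nY : \forall q \near ccoord c x,
      local_expr (coord_field c e) c' (tr c c' q) = 'd (tr c c') q e.
    apply: filterS (open_nbhs_nbhs (conj oA Az)) => _ [y [cy cy'] <-] /=.
    rewrite /local_expr !ccoordK //; apply: coord_fieldE.
    by split => //; case: cx'.
  have [_ H] := diff_comp_near nY tE dt (vfield_diff CY cx' (proj2 cx)).
  by apply/esym; exact: H.
(* Both sides of the transformation rule of [X] are differentiated along the line in the direction
   [e]. *)
have XE : 'd (local_expr X c') (ccoord c' x) ('d (tr c c') (ccoord c x) e) =
    'd (tr c c') (ccoord c x) ('d (local_expr X c) (ccoord c x) e) +
    'd (fun y => 'd (tr c c') y e) (ccoord c x) (X x c).
  have dX := vfield_diff CX cx Wx; have dX' := vfield_diff CX cx' Wx.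
  have nX : \forall q \near ccoord c x,
      local_expr X c' (tr c c' q) = local_expr X c' (tr c c' q)
    by apply: filterE => q.
  have [dXt dXtE] := diff_comp_near nX tE dt dX'.
  have D1 := @diff_line0 _ _ _ _ _ e dXt.
  have D2 := @C2_diff_along _ _ _ _ _ _ _ e oA C2t Az dX.
  have D1' : deriv_within setT (fun s : R => local_expr X c' (tr c c' (ccoord c x + s *: e)))
     0 ('d (local_expr X c') (ccoord c' x) ('d (tr c c') (ccoord c x) e)).
    by rewrite -(dXtE e); exact: D1.
  have D2' : deriv_within setT (fun s : R => local_expr X c' (tr c c' (ccoord c x + s *: e)))
     0 ('d (tr c c') (ccoord c x) ('d (local_expr X c) (ccoord c x) e) +
    'd (fun y => 'd (tr c c') y e) (ccoord c x) (X x c)).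
    rewrite -(local_exprE X (proj2 cx)).
    apply: (near_eq_deriv_within _ _ D2) => //.
    have nA : \forall q \near ccoord c x, (ccoord c @` (cdom c `&` cdom c')) q /\
        W (cparam c q).
      apply: filterI; first exact: (open_nbhs_nbhs (conj oA Az)).
      exact: (vfield_near CX (proj2 cx) Wx).
    have H := @line_cvg _ _ (ccoord c x) e _ nA.
    apply: (@filterS _ (nbhs (0 : R)) _ _ _ _ H) => s [[y [cy cy'] yE]].
    move=> Wq _; have Wy : W y by rewrite -(ccoordK cy) yE.
    rewrite -yE; apply: tspace_transition (vfield_tspace CX Wy).
      by split; [case: cx|exact: cy].
    by split; [case: cx'|exact: cy'].
  exact: deriv_within_unique (setT_proper 0) D1' D2'.
have subE (u v : 'rV[R]_m) : u - (v + u) = - v by rewrite opprD addrCA subrr addr0.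
apply: etrans (congr2 (fun u v => u - v) YE XE) (etrans (subE _ _) _).
by apply/esym; exact: linearN.
Qed.

End Bracket.

(** * The differential of a self-map of the manifold *)

Section Differential.
Context {R : realType} {m : nat} {M : manifoldC2 R m}.
Implicit Types (x : M) (c : chart R m M) (f g : M -> M).

Definition mdiff f x := {for x, continuous f} /\
  forall c c', chart_at x c -> chart_at (f x) c' ->
    differentiable (ccoord c' \o f \o cparam c) (ccoord c x).

Lemma some_chartP x : chart_at x (some_chart x).
Proof. exact: projT2 (cid (atlas_cover x)). Qed.

Lemma tdiffE f x (v : tvec M) c' : chart_at (f x) c' -> tdiff f x v c' =
  'd (ccoord c' \o f \o cparam (some_chart x)) (ccoord (some_chart x) x)
    (v (some_chart x)).
Proof. by move=> cx; rewrite /tdiff asboolT. Qed.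

Lemma tdiff_out f x (v : tvec M) c' : ~ chart_at (f x) c' -> tdiff f x v c' = 0.
Proof. by move=> cx; rewrite /tdiff asboolF. Qed.

Lemma mdiff_param f x c : mdiff f x -> chart_at x c ->
  {for ccoord c x, continuous (f \o cparam c)}.
Proof.
move=> [cf _] [_ cx]; have H := cparam_cvg cx.
have : (f \o cparam c) @ ccoord c x --> f x := cvg_comp _ _ H cf.
by rewrite /prop_for /continuous_at /= (ccoordK cx).
Qed.

Lemma tspace_tdiff f x (v : tvec M) : mdiff f x -> tspace (f x) (tdiff f x v).
Proof.
move=> df; split=> [c c' cx cx'|c]; last exact: tdiff_out.
rewrite (tdiffE v cx) (tdiffE v cx').
have sx := some_chartP x; have cf := mdiff_param df sx.
have E : (f \o cparam (some_chart x)) (ccoord (some_chart x) x) = f x.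
  by rewrite /= (ccoordK (proj2 sx)).
have [|||_ H] := @diff_chart_change _ _ _ _ (f \o cparam (some_chart x))
  (ccoord (some_chart x) x) c c' cf.
- by rewrite E.
- by rewrite E.
- exact: (proj2 df).
by move: (H (v (some_chart x))); rewrite E.
Qed.

Lemma diff_mcomp f g x c c1 c' : mdiff f x -> mdiff g (f x) ->
  chart_at x c -> chart_at (f x) c1 -> chart_at (g (f x)) c' ->
  differentiable (ccoord c' \o (g \o f) \o cparam c) (ccoord c x) /\
  forall v, 'd (ccoord c' \o (g \o f) \o cparam c) (ccoord c x) v =
    'd (ccoord c' \o g \o cparam c1) (ccoord c1 (f x))
      ('d (ccoord c1 \o f \o cparam c) (ccoord c x) v).
Proof.
move=> df dg cx cy cx'; apply: diff_comp_near.
- have fc : (f \o cparam c) @ ccoord c x --> f x.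
    exact: cvg_comp _ _ (cparam_cvg (proj2 cx)) (proj1 df).
  have H := fc _ (nbhs_cdom (proj2 cy)).
  by apply: (@filterS _ (nbhs (ccoord c x)) _ _ _ _ H) => z /= cz; rewrite ccoordK.
- by rewrite /= (ccoordK (proj2 cx)).
- exact: (proj2 df).
- exact: (proj2 dg).
Qed.

Lemma mdiff_comp f g x : mdiff f x -> mdiff g (f x) -> mdiff (g \o f) x.
Proof.
move=> df dg; split; first by apply: continuous_comp; [case: df|case: dg].
move=> c c' cx cx'.
by have [] := diff_mcomp df dg cx (some_chartP (f x)) cx'.
Qed.

Lemma tdiff_comp f g x (v : tvec M) : mdiff f x -> mdiff g (f x) ->
  tdiff (g \o f) x v = tdiff g (f x) (tdiff f x v).
Proof.
move=> df dg; apply/funext => c'.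
have [cx'|cx'] := pselect (chart_at (g (f x)) c'); last by rewrite !tdiff_out.
have cx := some_chartP x; have cy := some_chartP (f x).
rewrite (@tdiffE (g \o f) x v c' cx') (@tdiffE g _ _ c' cx') (tdiffE v cy).
have [_ dE] := diff_mcomp df dg cx cy cx'.
exact: dE.
Qed.

(** Stated locally because the flow at time 0 is known to be the identity only on an open part of
    the manifold. *)
Lemma tdiff_near_id f x (v : tvec M) : (\forall y \near x, f y = y) ->
  tspace x v -> tdiff f x v = v.
Proof.
move=> fid vT; have fx : f x = x := nbhs_singleton fid.
have [vE v0] := vT; apply/funext => c.
have [cx|cx] := pselect (chart_at x c); last by rewrite tdiff_out ?fx // v0.
have sx := some_chartP x.
have cx' : chart_at (f x) c by rewrite fx.
rewrite (tdiffE v cx') (vE _ _ sx cx).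
have H := cparam_cvg (proj2 sx) fid.
have [|_ E] := @near_eq_diff _ _ _ (ccoord c \o cparam (some_chart x))
  (ccoord c \o f \o cparam (some_chart x)) (ccoord (some_chart x) x) _
  (transition_diff sx cx).
  by apply: (@filterS _ (nbhs (ccoord (some_chart x) x)) _ _ _ _ H) => z /= ->.
exact: (congr1 (fun h => h (v (some_chart x))) E).
Qed.

Lemma mdiff_id x : mdiff id x.
Proof. by split=> [|c c' cx cx']; [exact: cvg_id|exact: transition_diff]. Qed.

Lemma tdiff_id x (v : tvec M) : tspace x v -> tdiff id x v = v.
Proof. by apply: tdiff_near_id; apply: filterE. Qed.

Lemma tdiff0 f x : tdiff f x 0 = 0.
Proof.
apply/funext => c; have [cx|cx] := pselect (chart_at (f x) c).
  by rewrite (tdiffE _ cx); exact: linear0.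
exact: tdiff_out.
Qed.

End Differential.

(** * Flows and parallel translation *)

Section Flow.
Context {R : realType} {m : nat} {M : manifoldC2 R m}.
Variables (W : set M) (X : M -> tvec M) (D : set (R * M)) (phi : R -> M -> M).
Hypothesis CX : vfield_C1 W X.
Hypothesis fX : local_flow W X D phi.
Implicit Types (x : M) (c : chart R m M) (t : R).

Definition flow_chart c c' (q : R^o * 'rV[R]_m) : 'rV[R]_m :=
  ccoord c' (phi q.1 (cparam c q.2)).

Definition flow_cdom c c' (q : R^o * 'rV[R]_m) :=
  [/\ (ccoord c @` cdom c) q.2, D (q.1, cparam c q.2) &
      cdom c' (phi q.1 (cparam c q.2))].

Lemma flow_cvg t x : D (t, x) ->
  (fun q : R * M => phi q.1 q.2) @ (t, x) --> phi t x.
Proof. by case: fX => _ _ _ _ [+ _] => /(_ (t, x)) H /H. Qed.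

Lemma flow_chart_cvg t x c : D (t, x) -> chart_at x c ->
  (fun q : R^o * 'rV[R]_m => (q.1, cparam c q.2)) @ (t : R^o, ccoord c x) -->
  ((t, x) : R * M).
Proof.
move=> Dtx [_ cx]; apply: cvg_pair_nbhs; first exact: cvg_fst.
by apply: (cvg_comp _ _ _ (cparam_cvg cx)); exact: cvg_snd.
Qed.

Lemma flow_cdom_near t x c c' : D (t, x) -> chart_at x c ->
  chart_at (phi t x) c' ->
  \forall q \near ((t : R^o, ccoord c x) : R^o * 'rV[R]_m), flow_cdom c c' q.
Proof.
move=> Dtx cx cx'; have H := flow_chart_cvg Dtx cx.
have oD : open D by case: fX.
have H1 := H _ (open_nbhs_nbhs (conj oD Dtx)).
have H2 := (cvg_comp _ _ H (flow_cvg Dtx)) _ (nbhs_cdom (proj2 cx')).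
have H3 : \forall q \near ((t : R^o, ccoord c x) : R^o * 'rV[R]_m),
    (ccoord c @` cdom c) q.2.
  by apply: cvg_snd; exact: nbhs_cimg (proj2 cx).
by apply: (@filterS3 _ (nbhs ((t : R^o, ccoord c x) : R^o * 'rV[R]_m)) _ _ _ _ _ _
  H1 H2 H3) => q.
Qed.

Lemma flow_chart_C1 c c' q : atlas c -> atlas c' -> flow_cdom c c' q ->
  differentiable (flow_chart c c') q /\
  forall v, {for q, continuous (fun q => 'd (flow_chart c c') q v)}.
Proof.
move=> ac ac' qD; case: fX => _ _ _ _ [_ /(_ c c' ac ac') C].
exact: C.
Qed.

Lemma flow_chart_deriv c c' s z : atlas c -> atlas c' -> flow_cdom c c' (s, z) ->
  deriv_within setT (fun s : R => flow_chart c c' (s, z)) s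
    (local_expr X c' (flow_chart c c' (s, z))).
Proof.
move=> ac ac' [_ /= Dsz cs].
have oD : open D by case: fX.
have [Wp [_ XT vX]] : W (phi s (cparam c z)) /\
    velocity [set s' | D (s', cparam c z)] (phi ^~ (cparam c z)) s
      (X (phi s (cparam c z))).
  by case: fX => _ _ _ + _; apply.
have Dn : nbhs s [set s' | D (s', cparam c z)].
  have H : (fun s' : R => (s', cparam c z)) @ s --> ((s, cparam c z) : R * M).
    by apply: cvg_pair_nbhs; [exact: cvg_id|exact: cvg_cst].
  exact: (H _ (open_nbhs_nbhs (conj oD Dsz))).
have H := vX c' (conj ac' cs).
rewrite (local_exprE X cs).
apply: is_derive_deriv_within.
exact: deriv_within_is_derive Dn H.
Qed.

Lemma flow_chart_space_diff c c' s z : atlas c -> atlas c' ->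
  flow_cdom c c' (s, z) ->
  differentiable (fun y => flow_chart c c' (s, y)) z /\
  forall v, 'd (fun y => flow_chart c c' (s, y)) z v =
    'd (flow_chart c c') (s : R^o, z) (0, v).
Proof.
move=> ac ac' qD; have [dF _] := flow_chart_C1 ac ac' qD.
have dp : is_diff z (fun y : 'rV[R]_m => (s : R^o, y)) (fun v => (0, v)).
  have d1 : is_diff z (cst (s : R^o) : 'rV[R]_m -> R^o) 0 by exact: is_diff_cst.
  have d2 : is_diff z (fun y : 'rV[R]_m => y) (fun v => v) by exact: is_diff_id.
  exact: is_diff_pair.
have [||dH dE] := @diff_comp_near _ _ _ _ (fun y : 'rV[R]_m => (s : R^o, y))
  (flow_chart c c') (fun y => flow_chart c c' (s, y)) z (s : R^o, z) _ erefl _ dF.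
- by apply: filterE.
- exact: ex_diff.
by split=> // v; apply: etrans (dE v) _; rewrite diff_val.
Qed.

(** Class C1 of the flow does not by itself allow its spatial derivative to be differentiated in
    time. [mixed_derivative] does: the time derivative of the flow is [X] along the flow, and this
    has a continuous spatial derivative by the chain rule. *)
Lemma flow_variation c c' t x (v : 'rV[R]_m) : D (t, x) -> chart_at x c ->
  chart_at (phi t x) c' ->
  deriv_within setT (fun s : R => 'd (fun y => flow_chart c c' (s, y)) (ccoord c x) v) t
    ('d (local_expr X c') (ccoord c' (phi t x))
      ('d (fun y => flow_chart c c' (t, y)) (ccoord c x) v)).
Proof.
move=> Dtx cx cx'; have [ac _] := cx; have [ac' _] := cx'.
have near_dom := flow_cdom_near Dtx cx cx'.
set z := ccoord c x in near_dom *.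
pose P (q : R * R) : R^o * 'rV[R]_m := (q.1, z + q.2 *: v).
have Pc : P @ (t, 0) --> ((t : R^o, z) : R^o * 'rV[R]_m).
  apply: cvg_pair_nbhs; first exact: cvg_fst.
  by apply: (cvg_comp _ _ _ (@line_cvg _ _ z v)); exact: cvg_snd.
have domP := Pc _ near_dom.
have Wflow q : flow_cdom c c' q -> chart_at (phi q.1 (cparam c q.2)) c' /\
    W (phi q.1 (cparam c q.2)).
  move=> [_ Dq cq]; split; first by split.
  by case: fX => _ _ _ + _ => /(_ _ _ Dq) [].
have dXq q : flow_cdom c c' q ->
    differentiable (local_expr X c') (flow_chart c c' q).
  by move=> /Wflow[cq Wq]; exact: vfield_diff CX cq Wq.
apply: deriv_within_row => j.
(* [u] is the derivative of the flow in the purely spatial direction [v], [Q] its velocity, and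
   [Phi] the derivative of [Q] along [v]. *)
pose u q := 'd (flow_chart c c') q ((0, v) : R^o * 'rV[R]_m).
pose G s r := flow_chart c c' (P (s, r)) 0 j.
pose Q s r := local_expr X c' (flow_chart c c' (P (s, r))) 0 j.
pose Phi q := 'd (local_expr X c') (flow_chart c c' q) (u q) 0 j.
have P0 : P (t, 0) = (t : R^o, z) by rewrite /P /= scale0r addr0.
have FE : flow_chart c c' (t : R^o, z) = ccoord c' (phi t x).
  by rewrite /flow_chart /= (ccoordK (proj2 cx)).
have uE s r : flow_cdom c c' (P (s, r)) ->
    'd (fun y => flow_chart c c' (s, y)) (z + r *: v) v = u (P (s, r)).
  by move=> Psr; have [_ H] := flow_chart_space_diff ac ac' Psr; exact: H.
have [_ cu] := flow_chart_C1 ac ac' (nbhs_singleton near_dom).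
have -> : 'd (local_expr X c') (ccoord c' (phi t x))
    ('d (fun y => flow_chart c c' (t, y)) z v) 0 j = Phi (P (t, 0)).
  rewrite P0 -[RHS]/('d (local_expr X c') (flow_chart c c' (t : R^o, z)) (u (t : R^o, z)) 0 j).
  rewrite FE; apply: (congr1 (fun w => 'd (local_expr X c') (ccoord c' (phi t x)) w 0 j)).
  have [_ H] := flow_chart_space_diff ac ac' (nbhs_singleton near_dom).
  exact: H.
apply: (@mixed_derivative R setT G Q (fun s r => Phi (P (s, r)))).
- apply: (@filterS _ (nbhs ((t, 0) : R * R)) _ _ _ _ domP) => -[s r] /= Psr; split.
    apply: deriv_within_coord; exact: flow_chart_deriv ac ac' Psr.
  have [dF dFE] := flow_chart_space_diff ac ac' Psr.
  have D1 : deriv_within setT (fun r => flow_chart c c' (P (s, r))) r (u (P (s, r))).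
    rewrite -(uE s r Psr).
    exact: (@diff_line _ _ _ (fun y => flow_chart c c' (s, y)) z v _ r erefl dF).
  exact: (deriv_within_coord (deriv_within_comp D1 (dXq _ Psr))).
- have H : \forall s \near t, flow_cdom c c' (s : R^o, z).
    have Hc : (fun s : R => (s : R^o, z)) @ t --> ((t : R^o, z) : R^o * 'rV[R]_m).
      by apply: cvg_pair_nbhs; [exact: cvg_id|exact: cvg_cst].
    exact: Hc _ near_dom.
  apply: filterS H => s qs; apply: deriv_within_coord.
  have [dF _] := flow_chart_space_diff ac ac' qs.
  exact: (@diff_line0 _ _ _ (fun y => flow_chart c c' (s, y)) z v dF).
- have cF : flow_chart c c' \o P @ (t, 0) --> flow_chart c c' (t : R^o, z).
    apply: cvg_comp Pc _; apply: differentiable_continuous.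
    by have [] := flow_chart_C1 ac ac' (nbhs_singleton near_dom).
  have cuP : u \o P @ (t, 0) --> u (t : R^o, z).
    exact: (cvg_comp _ _ Pc (cu _)).
  have cX w : {for flow_chart c c' (t : R^o, z), continuous
      (fun y => 'd (local_expr X c') y w)}.
    have [cq Wq] := Wflow _ (nbhs_singleton near_dom).
    case: CX => _ _ /(_ c' ac') C; rewrite /flow_chart.
    by have [_] := C _ (cimgI (proj2 cq) Wq); apply.
  rewrite P0.
  exact: (cvg_comp _ (fun M : 'rV_m => M 0 j) (diff_joint_cvg _ cX cF cuP)
    (@coord_continuous R 1 m 0 j _)).
Qed.

Lemma flow_mdiff t x : D (t, x) -> mdiff (phi t) x.
Proof.
move=> Dtx; split.
  have H : (fun y : M => (t, y)) @ x --> ((t, x) : R * M).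
    by apply: cvg_pair_nbhs; [exact: cvg_cst|exact: cvg_id].
  exact: (cvg_comp _ _ H (flow_cvg Dtx)).
move=> c c' cx cx'.
have H := nbhs_singleton (flow_cdom_near Dtx cx cx').
by have [] := flow_chart_space_diff (proj1 cx) (proj1 cx') H.
Qed.

Lemma flow_curve_cvg t x : D (t, x) -> (phi ^~ x) @ t --> phi t x.
Proof.
move=> Dtx; have H : (fun s : R => (s, x)) @ t --> ((t, x) : R * M).
  by apply: cvg_pair_nbhs; [exact: cvg_id|exact: cvg_cst].
exact: (cvg_comp _ _ H (flow_cvg Dtx)).
Qed.

Lemma flow_curve_deriv c t x : D (t, x) -> chart_at (phi t x) c ->
  deriv_within setT (ccoord c \o phi ^~ x) t (X (phi t x) c).
Proof.
move=> Dtx cx'; have cx := some_chartP x.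
have H := nbhs_singleton (flow_cdom_near Dtx cx cx').
have := flow_chart_deriv (proj1 cx) (proj1 cx') H.
rewrite /flow_chart /= (ccoordK (proj2 cx)).
by rewrite (local_exprE X (proj2 cx')).
Qed.

Lemma tdiff_flow_deriv c t x (v : tvec M) : D (t, x) -> chart_at (phi t x) c ->
  deriv_within setT (fun s => tdiff (phi s) x v c) t
    ('d (local_expr X c) (ccoord c (phi t x)) (tdiff (phi t) x v c)).
Proof.
move=> Dtx cx'; have cx := some_chartP x.
rewrite (tdiffE v cx').
have H := @flow_variation _ _ t x (v (some_chart x)) Dtx cx cx'.
apply: (near_eq_deriv_within _ _ H) => //.
have Hc := flow_curve_cvg Dtx (nbhs_cdom (proj2 cx')).
apply: (@filterS _ (nbhs t) _ _ _ _ Hc) => s cs _.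
by rewrite (tdiffE v (conj (proj1 cx') cs)).
Qed.

End Flow.

Section FlowCurve.
Context {R : realType}.

Lemma deriv_within_shift (V : normedModType R) (I : set R) (f : R -> V) a t l :
  deriv_within setT f (t - a) l -> deriv_within I (fun s => f (s - a)) t l.
Proof.
move=> fl A /fl; rewrite /= => Al.
have H : (t - a)^' (fun s => A ((s - (t - a))^-1 *: (f s - f (t - a)))).
  by apply: (@filterS _ (nbhs (t - a)) _ _ _ _ Al) => s /= As st; apply: As.
have {}H : t^' (fun s => A ((s - t)^-1 *: (f (s - a) - f (t - a)))).
  apply/dnbhs_shift; move/dnbhs_shift : H.
  by apply: (@filterS _ (0 : R)^' _) => h; rewrite !addrK addrA.
by apply: (@filterS _ t^' _ _ _ _ H) => s As _.
Qed.

Lemma segment_shift (a b t : R) : segment a b t -> segment 0 (b - a) (t - a).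
Proof.
rewrite /segment /= -(subrr a) -addr_minl -addr_maxl.
by rewrite !lerD2r.
Qed.

End FlowCurve.

(** * Horizontal lifts along an integral curve *)

Section Transport.
Context {R : realType} {m : nat} {M : manifoldC2 R m}.
Variables (N : set M) (n k : nat) (K : M -> set (tvec M)).
Hypothesis hN : submanifold_C2 N n.
Hypothesis hK : subbundle_C1 k K.
Hypothesis hKN : forall x, N x -> K x `<=` tspace_sub N n x.
Variables (W : set M) (X : M -> tvec M) (D : set (R * M)) (phi : R -> M -> M).
Hypothesis CX : vfield_C1 W X.
Hypothesis KX : tangent_section K W X.
Hypothesis fX : local_flow W X D phi.
Variables (a b : R) (x : M) (g : R -> M).
Hypothesis ab : a != b.
Hypothesis Dbx : D (b - a, x).
Hypothesis gE : forall s, segment a b s -> g s = phi (s - a) x.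
Hypothesis gN : forall s, segment a b s -> N (g s).
Implicit Types (c : chart R m M) (t s : R) (v w : tvec M).
Local Notation npart := (npart n).
Local Notation I := (segment a b).

Lemma curve_dom s : I s -> D (s - a, x).
Proof.
by move=> /segment_shift; case: fX => _ + _ _ _; apply.
Qed.

Lemma curve_domW s : I s -> W (g s).
Proof.
by move=> Is; rewrite gE //; case: fX => _ _ _ /(_ _ _ (curve_dom Is))[].
Qed.

Lemma curve_cvg t : I t -> g @ within I (nbhs t) --> g t.
Proof.
move=> It; rewrite (gE It) => A At.
have H : (fun s => phi (s - a) x) @ t --> phi (t - a) x.
  apply: (cvg_comp _ _ _ (flow_curve_cvg fX (curve_dom It))).
  by apply: cvgB; [exact: cvg_id|exact: cvg_cst].
by apply: (@filterS _ (nbhs t) _ _ _ _ (H _ At)) => s As Is; rewrite /= gE.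
Qed.

Lemma curve_velocity t : I t -> velocity I g t (X (g t)).
Proof.
move=> It; split; first exact: curve_cvg.
  exact: vfield_tspace CX (curve_domW It).
move=> c cx.
have cx' : chart_at (phi (t - a) x) c by rewrite -gE.
have H := @deriv_within_shift _ _ I _ a t _ (flow_curve_deriv fX (curve_dom It) cx').
rewrite [in X (g t)](gE It); apply: (near_eq_deriv_within It _ H).
by apply: (@filterE _ (nbhs t)) => s Is /=; rewrite gE.
Qed.

Definition push v s := tdiff (phi (s - a)) x v.

Lemma tspace_push v s : I s -> tspace (g s) (push v s).
Proof. by move=> Is; rewrite gE //; apply: tspace_tdiff; exact: (flow_mdiff fX (curve_dom Is)). Qed.

Lemma push_deriv c v t : I t -> chart_at (g t) c ->
  deriv_within I (fun s => push v s c) t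
    ('d (local_expr X c) (ccoord c (g t)) (push v t c)).
Proof.
move=> It cx; apply: (@deriv_within_shift _ _ I (fun s => tdiff (phi s) x v c)).
rewrite (gE It) in cx *.
exact: (tdiff_flow_deriv CX fX (curve_dom It) cx).
Qed.

Lemma curve_slice t : I t -> exists c, slice_chart N n c /\ cdom c (g t).
Proof. by move=> It; case: hN => _ /(_ _ (gN It)). Qed.

(** For a solution of [w' = L w] written in a coordinate frame, the coefficients have derivatives
    [L w 0 i] and the covariant derivatives of the frame have components [- L (delta_mx 0 i)]; the
    two contributions cancel. *)
Lemma linear_leibniz (L : {linear 'rV[R]_m -> 'rV[R]_m}) (w : 'rV[R]_m) :
  \sum_i (L w 0 i *: delta_mx 0 i + w 0 i *: - L (delta_mx 0 i)) = 0.
Proof.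
rewrite big_split /= -row_sum_delta {1}[w]row_sum_delta linear_sum -big_split /=.
by apply: big1 => i _; rewrite linearZ /= scalerN subrr.
Qed.

(** The left-hand side is a union over choices. Each member is tangent to [N] because the derivative
    of the normal components is unique, and a single choice already yields the whole zero coset. *)
Lemma nabla_along_push v t : I t ->
  nabla_along N n K I g (fun s => ncls N n (g s) (push v s)) t = ncls N n (g t) 0.
Proof.
move=> It; have [c [sc cx]] := curve_slice It.
have cA : chart_at (g t) c by split => //; case: sc.
have PF := segment_proper ab It.
have near_c : \forall s \near within I (nbhs t), cdom c (g s).
  exact: (curve_cvg It (nbhs_cdom cx)).
have Ws := curve_domW It.
have dp := @push_deriv c v t It cA.
apply/seteqP; split => u.
  move=> uN.
  have D1 := nabla_along_deriv hK hKN It PF sc cx (gN It) Ws CX KX (curve_velocity It) uN.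
  have uT : tspace (g t) u by case: uN => ? [? [? [? [? [? [? [_ _ _ _ []]]]]]]].
  split; first exact: uT.
  rewrite subr0; apply/(tspace_subP uT sc (gN It) cx).
  have D2 : deriv_within I (fun s => npart (nrep (ncls N n (g s) (push v s)) c)) t
      (npart ('d (local_expr X c) (ccoord c (g t)) (push v t c))).
    apply: (near_eq_deriv_within It _ (@deriv_within_npart _ _ n _ _ _ _ dp)).
    apply: (@filterS _ (nbhs t) _ _ _ _ near_c) => s cs Is.
    by rewrite (nrep_npart sc (cs Is) (@tspace_push v _ Is)).
  have := deriv_within_unique PF D1 D2.
  have -> : npart ('d (local_expr X c) (ccoord c (g t))
      (npart (nrep (ncls N n (g t) (push v t)) c))) =
    npart ('d (local_expr X c) (ccoord c (g t)) (push v t c)).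
    apply: (Ksection_diff_npart hKN sc cx (gN It) Ws CX KX).
    by rewrite npartK (nrep_npart sc cx (@tspace_push v _ It)).
  by move=> /eqP; rewrite -subr_eq0 addrK => /eqP.
move=> uN.
pose L := 'd (local_expr X c) (ccoord c (g t)).
(* The frame consists of the coordinate fields of the slice chart, the coefficients are the
   components of [push v], and each covariant derivative is the bracket with [X] itself. The
   resulting sum is exactly 0, so any [u] in the zero coset is reached. *)
exists (X (g t)), m, (cdom c), (fun i => coord_field c (delta_mx 0 i)),
  (fun i s => push v s c 0 i), (fun i => L (push v t c) 0 i),
  (fun i => lie_bracket X (coord_field c (delta_mx 0 i)) (g t)).
have bT i : tspace (g t) (lie_bracket X (coord_field c (delta_mx 0 i)) (g t)).
  by rewrite (lie_bracket_coord_field _ CX Ws cA); exact: tspace_coord_field.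
split.
- by split; [exact: curve_velocity|].
- split=> i; first by apply: coord_field_C1; case: cA.
  exact: deriv_within_coord dp.
- apply: (@filterS _ (nbhs t) _ _ _ _ near_c) => s cs Is.
  by rewrite -(coord_field_basis (@tspace_push v _ Is) (conj (proj1 cA) (cs Is))).
- move=> i; exists (W `&` cdom c), X, (coord_field c (delta_mx 0 i)); split => //.
  + have [oW _ _] := CX; have oI := openI oW (cdom_open c).
    have CY := coord_field_C1 (delta_mx 0 i) (proj1 cA).
    by split; [apply: vfield_C1_sub CX|apply: vfield_C1_sub CY] => // y [].
  + by split=> // y [Wy _]; exact: KX.
  + exact: ncls_refl.
suff -> : \sum_i (L (push v t c) 0 i *: coord_field c (delta_mx 0 i) (g t) +
    push v t c 0 i *: lie_bracket X (coord_field c (delta_mx 0 i)) (g t)) = 0 by [].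
apply: (tspace_eq (x := g t) _ (tspace0 _) cA).
  apply: tspace_sum => i; apply: tspaceD; apply: tspaceZ; last exact: bT.
  exact: tspace_coord_field.
rewrite tvec_sum -[RHS](linear_leibniz L (push v t c)); apply: eq_bigr => i _.
rewrite tvecD !tvecZ (lie_bracket_coord_field _ CX Ws cA) !coord_field_id //.
Qed.

Lemma horizontal_deriv c eta t : I t -> slice_chart N n c -> cdom c (g t) ->
  horizontal_lift N n K I g eta ->
  deriv_within I (fun s => npart (nrep (eta s) c)) t
    (npart ('d (local_expr X c) (ccoord c (g t)) (npart (nrep (eta t) c)))).
Proof.
move=> It sc cx /(_ t It)[_ etaN].
have H0 : nabla_along N n K I g eta t 0.
  by rewrite etaN; apply: ncls_refl; exact: tspace0.
have H := nabla_along_deriv hK hKN It (segment_proper ab It) sc cx (gN It)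
  (curve_domW It) CX KX (curve_velocity It) H0.
have E : npart ((0 : tvec M) c) = 0 by exact: npart0.
by move: H; rewrite E add0r.
Qed.

Lemma horizontal_eq c eta eta' s : I s -> slice_chart N n c -> cdom c (g s) ->
  horizontal_lift N n K I g eta -> horizontal_lift N n K I g eta' ->
  eta s = eta' s <-> npart (nrep (eta s) c) = npart (nrep (eta' s) c).
Proof.
move=> Is sc cx /(_ s Is)[[v vT <-] _] /(_ s Is)[[w wT <-] _].
rewrite !nrep_npart //; split=> [/(ncls_eq N n vT wT)|vw].
  by move/(tspace_subP (tspaceB vT wT) sc (gN Is) cx); rewrite npartB => /subr0_eq.
apply/(ncls_eq N n vT wT)/(tspace_subP (tspaceB vT wT) sc (gN Is) cx).
by rewrite npartB vw subrr.
Qed.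

(** Agreement at a time is a locally constant property: in a slice chart the difference of the
    normal components solves a linear equation with bounded coefficients, so on a short interval it
    vanishes everywhere once it vanishes somewhere. *)
Lemma horizontal_unique eta eta' :
  horizontal_lift N n K I g eta -> horizontal_lift N n K I g eta' ->
  eta a = eta' a -> forall s, I s -> eta s = eta' s.
Proof.
move=> He He'; apply: segment_locally_constant => t It.
have [c [sc cx]] := curve_slice It.
have cA : chart_at (g t) c by split => //; case: sc.
have Ws := curve_domW It.
have [|L L0 HL] := @linear_bounded_near _ _ _ (fun z => 'd (local_expr X c) z) (ccoord c (g t)).
  case: CX => _ _ /(_ c (proj1 cA)) C.
  by have [_] := C _ (cimgI cx Ws).
have near_t : \forall s \near within I (nbhs t), cdom c (g s) /\
    forall v : 'rV[R]_m, `|'d (local_expr X c) (ccoord c (g s)) v| <= L * `|v|.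
  have H : \forall y \near g t, cdom c y /\
      forall v : 'rV[R]_m, `|'d (local_expr X c) (ccoord c y) v| <= L * `|v|.
    apply: filterI; first exact: nbhs_cdom.
    exact: (ccoord_cont cx HL).
  exact: (curve_cvg It H).
have [e e0 He0] : exists2 e, 0 < e & forall s, I s -> `|s - t| <= e ->
    cdom c (g s) /\
    forall v : 'rV[R]_m, `|'d (local_expr X c) (ccoord c (g s)) v| <= L * `|v|.
  have [e /= e0 Be] := (nbhs_ballP t _).1 near_t.
  exists (e / 2); first exact: divr_gt0.
  move=> s Is st; apply: Be => //; rewrite /ball /= distrC (le_lt_trans st) //.
  by rewrite ltr_pdivrMr // ltr_pMr // ltr1n.
(* [d <= e] keeps the curve in the chart, where the bound [L] holds; the other term gives
   [L * (2 * d) <= 1 / 2] on an interval of length at most [2 * d], with [L + 1] as divisor in case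
   [L = 0]. *)
pose d := Num.min e (1 / (4 * (L + 1))).
have L1 : 0 < 4 * (L + 1) by rewrite mulr_gt0 // ltr_wpDl.
have d0 : 0 < d by rewrite lt_min e0 divr_gt0.
have de : d <= e by rewrite ge_min lexx.
pose lo := Num.max (Num.min a b) (t - d).
pose hi := Num.min (Num.max a b) (t + d).
have JI s : lo <= s <= hi <-> I s /\ `|s - t| <= d.
  rewrite ge_max le_min ler_distl; split.
    by move=> /andP[/andP[? ?] /andP[? ?]]; split; apply/andP.
  by move=> [/andP[-> ->] /andP[-> ->]].
have tJ : lo <= t <= hi by apply/JI; rewrite subrr normr0 ltW.
have lohi : lo <= hi by case/andP: tJ => /le_trans; apply.
pose dl s := npart (nrep (eta s) c) - npart (nrep (eta' s) c).
have Z : forall s0, lo <= s0 <= hi -> dl s0 = 0 -> forall s, lo <= s <= hi -> dl s = 0.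
  apply: (@linear_ODE_zero R m lo hi L dl (fun s =>
    npart ('d (local_expr X c) (ccoord c (g s)) (npart (nrep (eta s) c))) -
    npart ('d (local_expr X c) (ccoord c (g s)) (npart (nrep (eta' s) c))))) => //.
    have hl : hi - lo <= 2 * d.
      have h1 : hi <= t + d by rewrite ge_min lexx orbT.
      have h2 : t - d <= lo by rewrite le_max lexx orbT.
      apply: le_trans (lerB h1 h2) _.
      by rewrite opprB addrA addrAC [t + d]addrC addrK mulr_natl mulr2n.
    apply: le_trans (ler_wpM2l L0 hl) _.
    have : d <= 1 / (4 * (L + 1)) by rewrite ge_min lexx orbT.
    by rewrite ler_pdivlMr // => dL; nra.
  move=> s /JI[Is st]; have [cs Hs] := He0 s Is (le_trans st de); split.
    apply: (@sub_deriv_within _ _ _ I) => [u|].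
      by rewrite /= in_itv /= => /JI[].
    by apply: deriv_withinB; exact: horizontal_deriv.
  rewrite -npartB -linearB; apply: le_trans (npart_norm _ _) _; exact: Hs.
have near_J : \forall s \near within I (nbhs t), lo <= s <= hi.
  apply/(nbhs_ballP t _); exists d => // s st Is; apply/JI; split => //.
  by rewrite distrC ltW.
apply: (@filterS _ (nbhs t) _ _ _ _ near_J) => s Js Is.
have sJ := Js Is; have [_ st] := (JI s).1 sJ.
have [cs _] := He0 s Is (le_trans st de).
have Ps := horizontal_eq Is sc cs He He'; have Pt := horizontal_eq It sc cx He He'.
(* Both implications are instances of [Z], with the zero at [s] for the first and at [t] for the
   second. *)
split=> [/Ps E|/Pt E]; [apply/Pt|apply/Ps]; apply/subr0_eq.
  by apply: (Z s sJ) => //; rewrite /dl E subrr.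
by apply: (Z t tJ) => //; rewrite /dl E subrr.
Qed.

Lemma push_horizontal v :
  horizontal_lift N n K I g (fun s => ncls N n (g s) (push v s)).
Proof.
by move=> t It; split; [exists (push v t) => //; exact: tspace_push|
  exact: nabla_along_push].
Qed.

(** Uniqueness of lifts also shows that the differential of the flow preserves [TN]: a vector [v]
    tangent to [N] has the class of 0 at [x], so the lifts given by [push v] and [push 0] coincide,
    and [push 0] vanishes. *)
Lemma flow_transport :
  (forall v, tspace_sub N n x v -> tspace_sub N n (g b) (tdiff (phi (b - a)) x v)) /\
  forall v, tspace x v -> forall z,
    parallel_translation N n K I g a b (ncls N n x v) z <->
    z = ncls N n (g b) (tdiff (phi (b - a)) x v).
Proof.
have Ia := segment_left a b; have Ib := segment_right a b.
have phi0 y : D (0, y) -> phi 0 y = y by case: fX => _ _ + _ _; apply.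
have D0x : D (0, x) by rewrite -(subrr a); exact: curve_dom.
have gax : g a = x by rewrite gE // subrr phi0.
have push0 v : tspace x v -> push v a = v.
  rewrite /push subrr; apply: tdiff_near_id.
  have H : (fun y : M => (0 : R, y)) @ x --> ((0, x) : R * M).
    by apply: cvg_pair_nbhs; [exact: cvg_cst|exact: cvg_id].
  have oD : open D by case: fX.
  have H0 := H _ (open_nbhs_nbhs (conj oD D0x)).
  by apply: (@filterS _ (nbhs x) _ _ _ _ H0) => y; exact: phi0.
split=> [v vS|v vT z].
  have vT : tspace x v by case: vS.
  have H := horizontal_unique (push_horizontal v) (push_horizontal 0).
  have E0 s : push 0 s = 0 by exact: tdiff0.
  have : ncls N n (g b) (push v b) = ncls N n (g b) (push 0 b).
    apply: H Ib; rewrite E0 push0 // gax.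
    by apply/(ncls_eq N n vT (tspace0 x)); rewrite subr0.
  move/(ncls_eq N n (@tspace_push v _ Ib) (@tspace_push 0 _ Ib)).
  by rewrite E0 subr0.
split=> [[eta [He Ea Eb]]|->].
  rewrite -Eb; apply: (horizontal_unique He (push_horizontal v) _ Ib).
  by rewrite Ea push0 // gax.
exists (fun s => ncls N n (g s) (push v s)); split => //; first exact: push_horizontal.
by rewrite push0 // gax.
Qed.

End Transport.

(** * Composition over the pieces of the curve *)

Lemma increments_ndecr (R : realType) (p : nat) (t : nat -> R) :
  (forall i, (i < p)%N -> t i < t i.+1) ->
  forall i j, (i <= j <= p)%N -> t i <= t j.
Proof.
move=> tS i j; elim: j => [|j IH]; first by rewrite leqn0 andbC => /andP[_ /eqP ->].
move=> /andP[]; rewrite leq_eqVlt => /orP[/eqP -> //|ij] jp.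
by rewrite (le_trans (IH _)) ?(ltW (tS _ _)) // -ltnS ij ltnW.
Qed.

Theorem proposition1p2 (R : realType) (m n k : nat) (M : manifoldC2 R m)
    (N : set M) (hN : submanifold_C2 N n)
    (K : M -> set (tvec M)) (hK : subbundle_C1 k K)
    (hKN : forall x, N x -> K x `<=` tspace_sub N n x) :
  (* a single integral curve *)
  (forall (W : set M) (X : M -> tvec M) (D : set (R * M)) (phi : R -> M -> M)
      (T : R) (gamma : R -> M) (x1 x2 : M),
    vfield_C1 W X -> tangent_section K W X -> local_flow W X D phi ->
    T != 0 -> D (T, x1) ->
    (forall t, segment 0 T t -> gamma t = phi t x1 /\ N (gamma t)) ->
    gamma 0 = x1 -> gamma T = x2 ->
    induced_normal_map N n (phi T) x1 x2
      (parallel_translation N n K (segment 0 T) gamma 0 T))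
  /\
  (* a piecewise smooth curve formed of p integral curves *)
  (forall (p : nat) (W : nat -> set M) (X : nat -> M -> tvec M)
      (D : nat -> set (R * M)) (phi : nat -> R -> M -> M)
      (t : nat -> R) (gamma : R -> M) (x1 x2 : M),
    (forall i, (i < p)%N ->
      [/\ vfield_C1 (W i) (X i), tangent_section K (W i) (X i),
          local_flow (W i) (X i) (D i) (phi i), t i < t i.+1 &
          D i (t i.+1 - t i, gamma (t i)) /\
          forall s, segment (t i) (t i.+1) s ->
            gamma s = phi i (s - t i) (gamma (t i))]) ->
    (forall s, segment (t 0%N) (t p) s -> N (gamma s)) ->
    gamma (t 0%N) = x1 -> gamma (t p) = x2 ->
    induced_normal_map N n (composed_flow phi t p) x1 x2
      (pw_parallel_translation N n K p t gamma)).
Proof.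
split.
  move=> W X D phi T gamma x1 x2 CX KX fX T0 DT gE g0 gT.
  have IT := segment_right 0 T.
  (* The single curve is the case [a = 0] of [flow_transport], where flow times have the form
     [s - a]. *)
  have DT' : D (T - 0, x1) by rewrite subr0.
  have gE' s : segment 0 T s -> gamma s = phi (s - 0) x1.
    by move=> /gE[]; rewrite subr0.
  have gN s : segment 0 T s -> N (gamma s) by move=> /gE[].
  have T0' : 0 != T by rewrite eq_sym.
  have [] := flow_transport hN hK hKN CX KX fX T0' DT' gE' gN.
  by rewrite gT subr0 => tsubP PT; split => //; rewrite -gT; have [] := gE T IT.
move=> p W X D phi t gamma x1 x2 H gN g0 gp.
have tS i : (i < p)%N -> t i < t i.+1 by move=> /H[].
have tle := @increments_ndecr _ _ _ tS.
(* Each piece is an integral curve restarted at time 0 from [gamma (t i)], to which [flow_transport]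
   applies. *)
have piece i : (i < p)%N -> [/\ phi i (t i.+1 - t i) (gamma (t i)) = gamma (t i.+1),
    mdiff (phi i (t i.+1 - t i)) (gamma (t i)),
    (forall v, tspace_sub N n (gamma (t i)) v -> tspace_sub N n (gamma (t i.+1))
      (tdiff (phi i (t i.+1 - t i)) (gamma (t i)) v)) &
    forall v, tspace (gamma (t i)) v -> forall z,
      parallel_translation N n K (segment (t i) (t i.+1)) gamma (t i) (t i.+1)
        (ncls N n (gamma (t i)) v) z <->
      z = ncls N n (gamma (t i.+1)) (tdiff (phi i (t i.+1 - t i)) (gamma (t i)) v)].
  move=> ip; have [CX KX fX tti [Di gE]] := H i ip.
  have gN' s : segment (t i) (t i.+1) s -> N (gamma s).
    have t0p : t 0%N <= t p by apply: tle; rewrite leqnn.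
    have tti' := ltW tti.
    have t0i : t 0%N <= t i by apply: tle; rewrite leq0n ltnW.
    have tip : t i.+1 <= t p by apply: tle; rewrite ip leqnn.
    move=> st; apply: gN; move: st.
    rewrite /segment /= (min_l t0p) (max_r t0p) (min_l tti') (max_r tti').
    by move=> /andP[is1 si1]; rewrite (le_trans t0i) ?(le_trans si1).
  have [PS PT] := flow_transport hN hK hKN CX KX fX (negbT (lt_eqF tti)) Di gE gN'.
  split; [|exact: (flow_mdiff fX Di)|exact: PS|exact: PT].
  by rewrite -gE //; exact: segment_right.
have comp i : (i <= p)%N -> [/\ composed_flow phi t i x1 = gamma (t i),
    mdiff (composed_flow phi t i) x1 &
    forall v, tspace_sub N n x1 v ->
      tspace_sub N n (gamma (t i)) (tdiff (composed_flow phi t i) x1 v)].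
  elim: i => [_|i IH ip].
    split=> //; first exact: mdiff_id.
    move=> v vS; rewrite g0.
    suff -> : tdiff (composed_flow phi t 0) x1 v = v by [].
    by apply: tdiff_id; case: vS.
  have [fE df fS] := IH (ltnW ip); have [pE dp pS _] := piece i ip.
  rewrite -fE in pE dp.
  split; [by []|exact: (mdiff_comp df dp)|].
  move=> v vS; have := pS _ (fS v vS).
  by rewrite -fE -(@tdiff_comp _ _ _ _ _ _ v df dp).
have compT i v : (i < p)%N -> tdiff (composed_flow phi t i.+1) x1 v =
    tdiff (phi i (t i.+1 - t i)) (gamma (t i)) (tdiff (composed_flow phi t i) x1 v).
  move=> ip; have [fE df _] := comp i (ltnW ip); have [_ dp _ _] := piece i ip.
  by rewrite -fE in dp *; exact: tdiff_comp.
have fT i v : (i <= p)%N -> tspace (gamma (t i)) (tdiff (composed_flow phi t i) x1 v).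
  by move=> ip; have [<- df _] := comp i ip; exact: tspace_tdiff.
have [fpE _ fpS] := comp p (leqnn p).
split; [by rewrite fpE gp|by rewrite -gp; exact: fpS|move=> v vT z].
have f0 : tdiff (composed_flow phi t 0) x1 v = v by exact: tdiff_id.
split=> [[zs [z0 <- Hz]]|->].
  rewrite -gp.
  have : (p <= p)%N by [].
  (* The number of pieces traversed is generalized, while the bound [p], up to which [Hz] holds,
     stays fixed. *)
  elim: {1 3 4 5}p => [_|i IH ip]; first by rewrite z0 g0 f0.
  have [_ _ _ /(_ _ (fT i v (ltnW ip))) PT] := piece i ip.
  by rewrite (compT i v ip); apply/PT; rewrite -IH ?(ltnW ip) //; exact: Hz.
(* The intermediate values are the classes of [v] pushed by the first [i] flows. *)
exists (fun i => ncls N n (gamma (t i)) (tdiff (composed_flow phi t i) x1 v)).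
split; [by rewrite f0 g0|by rewrite gp|move=> i ip].
have [_ _ _ /(_ _ (fT i v (ltnW ip))) PT] := piece i ip.
by apply/PT; rewrite compT.
Qed.
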